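(* Triangle Enumeration parameterized by the feedback edge number $k$ can be solved in $O(k^{1.5}+n+m)$ time.
   Context: Triangle Enumeration: given an undirected simple graph $G$ with $n$ vertices and $m$ edges, list all triangles (sets of three pairwise adjacent vertices) of $G$. The feedback edge number of $G$ is the minimum size of a set $F\subseteq E(G)$ such that removing the edges of $F$ from $G$ yields a forest. *)

(* Defs.v *)
From mathcomp Require Import all_boot all_order.
From Stdlib Require PeanoNat.
Set Implicit Arguments. Unset Strict Implicit. Unset Printing Implicit Defensive.

(* Graphs: a simple undirected graph on 'I_n is a set of 2-subsets.     *)

Definition adj (n : nat) (E : {set {set 'I_n}}) (x y : 'I_n) : bool :=
  [set x; y] \in E.

Definition is_cycle (n : nat) (E : {set {set 'I_n}}) (s : seq 'I_n) : bool :=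
  if s is x :: s' then
    [&& 3 <= size s, uniq s & cycle (adj E) s]
  else false.

(* forest: no cycle; a cycle has pairwise distinct vertices, hence at most
   n of them, so it suffices to range over k-tuples with k <= n *)
Definition forest (n : nat) (E : {set {set 'I_n}}) : bool :=
  [forall k : 'I_n.+1, forall s : k.-tuple 'I_n, ~~ is_cycle E s].

(* feedback edge number: minimum |F|, F a subset of E, such that E \ F is a
   forest (E itself is always such an F, so #|E| is a valid initial value). *)
Definition feedback_edge_number (n : nat) (E : {set {set 'I_n}}) : nat :=
  \big[minn/#|E|]_(F : {set {set 'I_n}} |
        (F \subset E) && forest (E :\: F)) #|F|.

Definition triangle (n : nat) (E : {set {set 'I_n}}) (T : {set 'I_n}) : Prop :=
  #|T| = 3 /\ forall x y, x \in T -> y \in T -> x != y -> adj E x y.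

Inductive binop := OAdd | OSub | OMul | ODiv | OMod | OLt | OEq.

Definition eval_binop (o : binop) (a b : nat) : nat :=
  match o with
  | OAdd => a + b
  | OSub => a - b            (* truncated *)
  | OMul => a * b
  | ODiv => a %/ b           (* x %/ 0 = 0 *)
  | OMod => a %% b           (* x %% 0 = x *)
  | OLt  => (a < b : nat)
  | OEq  => (a == b : nat)
  end.

Inductive instr :=
  | IConst (d v : nat)
  | IBin (o : binop) (d a b : nat)
  | ILoad (d a : nat)
  | IStore (a s : nat)
  | IRead (d a : nat)             (* M[d] := input[M[a]] (0 if out of range) *)
  | IJz (a t : nat)
  | IOut (a : nat).

Definition program := seq instr.

Record config := Config { pc : nat; mem : nat -> nat; out : seq nat }.

Definition upd (m : nat -> nat) (a v : nat) : nat -> nat :=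
  fun x => if x == a then v else m x.

Definition step (P : program) (inp : seq nat) (c : config) : option config :=
  let: Config p m o := c in
  if p < size P then
    Some match nth (IOut 0) P p with
    | IConst d v => Config p.+1 (upd m d v) o
    | IBin op d a b => Config p.+1 (upd m d (eval_binop op (m a) (m b))) o
    | ILoad d a => Config p.+1 (upd m d (m (m a))) o
    | IStore a s => Config p.+1 (upd m (m a) (m s)) o
    | IRead d a => Config p.+1 (upd m d (nth 0 inp (m a))) o
    | IJz a t => Config (if m a == 0 then t else p.+1) m o
    | IOut a => Config p.+1 m (rcons o (m a))
    end
  else None.

Fixpoint exec (P : program) (inp : seq nat) (t : nat) (c : config) : option config :=
  match t with
  | 0 => Some c
  | t'.+1 => if step P inp c is Some c' then exec P inp t' c' else None
  end.

Definition init_config : config := Config 0 (fun _ => 0) [::].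

(* P on input inp halts after exactly t steps with output o, and every
   memory cell holds a value <= B at every step (word-size restriction). *)
Definition runs (P : program) (inp : seq nat) (t : nat) (o : seq nat) (B : nat) : Prop :=
  (forall i c, i <= t -> exec P inp i init_config = Some c ->
     forall a, mem c a <= B) /\
  exists c, exec P inp t init_config = Some c /\ step P inp c = None /\ out c = o.

Definition encode (n : nat) (es : seq ('I_n * 'I_n)) : seq nat :=
  [:: n, size es & flatten [seq [:: val e.1; val e.2] | e <- es]].

Definition valid_edges (n : nat) (es : seq ('I_n * 'I_n)) : bool :=
  all (fun e => e.1 != e.2) es && uniq [seq [set e.1; e.2] | e <- es].

Definition edge_set (n : nat) (es : seq ('I_n * 'I_n)) : {set {set 'I_n}} :=
  [set [set e.1; e.2] | e in es].

Definition chunk_set (n : nat) (s : seq nat) : {set 'I_n} :=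
  [set x : 'I_n | val x \in s].

Definition enumerates (n : nat) (E : {set {set 'I_n}}) (o : seq nat) : Prop :=
  exists Ls : seq (seq nat),
    o = flatten Ls /\
    all (fun s => [&& size s == 3, uniq s & all (fun x => x < n) s]) Ls /\
    uniq [seq chunk_set n s | s <- Ls] /\
    forall T : {set 'I_n}, T \in [seq chunk_set n s | s <- Ls] <-> triangle E T.

(* Main.v *)
Require Import Defs.
From mathcomp Require Import all_boot all_order.
From mathcomp Require Import zify.
From Stdlib Require PeanoNat.
Set Implicit Arguments. Unset Strict Implicit. Unset Printing Implicit Defensive.

(* Repeatedly delete vertices of degree one; none of them lies on a triangle, and
   storing for every vertex the sum of its neighbours makes the last remaining
   neighbour available in constant time.  In the remaining graph every vertex has
   degree 0 or at least 2, and since a forest has at most as many edges as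
   vertices, the sum of d(v) - 2 over the vertices of positive degree is at most
   2k; hence the degrees that are at least 3 add up to at most 6k.

   Orient every remaining edge towards the endpoint of larger degree (ties broken
   by index), and for every vertex u test all pairs of out-neighbours of u for
   adjacency, in an adjacency matrix that needs no initialisation because memory
   starts at zero.  The out-neighbours of u have degree at least d(u), so when
   d(u) >= 3 we get outdeg(u)^2 <= outdeg(u) d(u) <= 6k.  Hence
   outdeg(u) = O(sqrt k), and the sum of outdeg(u)^2 is O(k sqrt k + n).

   The program is written in a small language of expressions and while loops,
   compiled to the RAM; weakest preconditions account for time and for the
   size of the stored values. *)

(** * Compiling while programs to the RAM *)

Inductive expr :=
  | Const (v : nat)
  | Cell (a : nat) (e : expr)
  | Bin (o : binop) (e1 e2 : expr)
  | Input (e : expr).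

Inductive cmd :=
  | Store (a : nat) (e1 e2 : expr)
  | Print (e : expr)
  | Seq (c1 c2 : cmd)
  | If (e : expr) (c : cmd)
  | While (e : expr) (c : cmd).

Record state := State { cell : nat -> nat -> nat; outp : seq nat; clock : nat }.

Definition setc (s : nat -> nat -> nat) (a i v : nat) : nat -> nat -> nat :=
  fun b j => if (b == a) && (j == i) then v else s b j.

Definition tick (s : state) := State (cell s) (outp s) (clock s).+1.

Definition write (s : state) (a i v : nat) :=
  State (setc (cell s) a i v) (outp s) (clock s).+1.

Definition print (s : state) (v : nat) :=
  State (cell s) (rcons (outp s) v) (clock s).+1.

Fixpoint eval (inp : seq nat) (s : nat -> nat -> nat) (e : expr) : nat :=
  match e with
  | Const v => v
  | Cell a e => s a (eval inp s e)
  | Bin o e1 e2 => eval_binop o (eval inp s e1) (eval inp s e2)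
  | Input e => nth 0 inp (eval inp s e)
  end.

(* Memory layout: address 16 k holds the k-th temporary, and cell i of array a
   lives at address 16 i + a + 1. *)
Definition temp (k : nat) := 16 * k.
Definition addr (a i : nat) := 16 * i + a.+1.

(** Arithmetic instructions take only cells as operands, so the constants 16 and [a.+1] pass through
    the temporary [k.+1]. *)
Definition addr_code (k a : nat) : seq instr :=
  [:: IConst (temp k.+1) 16; IBin OMul (temp k) (temp k) (temp k.+1);
      IConst (temp k.+1) a.+1; IBin OAdd (temp k) (temp k) (temp k.+1)].

Fixpoint expr_code (k : nat) (e : expr) : seq instr :=
  match e with
  | Const v => [:: IConst (temp k) v]
  | Cell a e => expr_code k e ++ addr_code k a ++ [:: ILoad (temp k) (temp k)]
  | Bin o e1 e2 =>
      expr_code k e1 ++ expr_code k.+1 e2 ++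
      [:: IBin o (temp k) (temp k) (temp k.+1)]
  | Input e => expr_code k e ++ [:: IRead (temp k) (temp k)]
  end.

(** Jump targets are absolute, hence the parameter [p], the address at which the code is placed. The
    only jump is conditional on zero, so a loop returns to its test by first putting 0 into
    [temp 0]. *)
Fixpoint cmd_code (p : nat) (c : cmd) : seq instr :=
  match c with
  | Store a e1 e2 =>
      expr_code 0 e1 ++ addr_code 0 a ++ expr_code 1 e2 ++
      [:: IStore (temp 0) (temp 1)]
  | Print e => expr_code 0 e ++ [:: IOut (temp 0)]
  | Seq c1 c2 =>
      let k1 := cmd_code p c1 in k1 ++ cmd_code (p + size k1) c2
  | If e c =>
      let ke := expr_code 0 e in
      let kc := cmd_code (p + (size ke).+1) c in
      ke ++ IJz (temp 0) (p + (size ke).+1 + size kc) :: kc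
  | While e c =>
      let ke := expr_code 0 e in
      let kc := cmd_code (p + (size ke).+1) c in
      ke ++ IJz (temp 0) (p + (size ke).+1 + size kc + 2) ::
      kc ++ [:: IConst (temp 0) 0; IJz (temp 0) p]
  end.

(* [esize e] is the exponent in the bound [V ^ esize e] on the value of [e] when
   all cells are at most [V]. *)
Fixpoint esize (e : expr) : nat :=
  match e with
  | Const _ => 1
  | Cell _ e => (esize e).+1
  | Bin _ e1 e2 => esize e1 + esize e2
  | Input e => esize e
  end.

(** Arrays below 15 occupy the residues 1 to 15 modulo 16, away from the temporaries at residue 0.
    The limit 32 on constants matches the later assumption [32 <= V]. *)
Fixpoint wf_expr (e : expr) : bool :=
  match e with
  | Const v => v <= 32
  | Cell a e => (a < 15) && wf_expr e
  | Bin _ e1 e2 => wf_expr e1 && wf_expr e2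
  | Input e => wf_expr e
  end.

(** Exponent 20 leaves one factor [V] for an address within [V ^ 21]. With at most 90 instructions
    there is room for address code, store and jumps within the 100 steps of a clock unit. *)
Definition small_expr (e : expr) : bool :=
  [&& wf_expr e, esize e <= 20 & size (expr_code 0 e) <= 90].

Fixpoint wf_cmd (c : cmd) : bool :=
  match c with
  | Store a e1 e2 =>
      [&& a < 15, small_expr e1, small_expr e2 &
          size (expr_code 0 e1) + size (expr_code 1 e2) <= 90]
  | Print e => small_expr e
  | Seq c1 c2 => wf_cmd c1 && wf_cmd c2
  | If e c | While e c => small_expr e && wf_cmd c
  end.

(** * RAM runs of exact length with bounded memory *)

Section Machine.

Variables (inp : seq nat) (V : nat).
Hypothesis V_ge : 32 <= V.
Hypothesis inp_le : forall i, nth 0 inp i <= V.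

Definition bound := V ^ 21.

Definition bounded (m : nat -> nat) := forall x, m x <= bound.

Inductive reach (P : program) : nat -> config -> config -> Prop :=
  | reach0 c : bounded (Defs.mem c) -> reach P 0 c c
  | reachS t c c' c'' : bounded (Defs.mem c) -> step P inp c = Some c' ->
      reach P t c' c'' -> reach P t.+1 c c''.

Lemma reach_trans P t1 t2 c1 c2 c3 :
  reach P t1 c1 c2 -> reach P t2 c2 c3 -> reach P (t1 + t2) c1 c3.
Proof. by elim=> // {t1 c1 c2} t c c' c'' bc st _ IH /IH; apply: reachS. Qed.

Lemma reach_bounded P t c c' : reach P t c c' -> bounded (Defs.mem c').
Proof. by elim. Qed.

Lemma reach_exec P t c c' : reach P t c c' ->
  exec P inp t c = Some c' /\
  forall i d, i <= t -> exec P inp i c = Some d -> bounded (Defs.mem d).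
Proof.
elim=> {t c c'} [c bc|t c c' c'' bc st _ [IH1 IH2]].
  by split=> // -[|i] d //= _ [<-].
split=> [|[|i] d ile /=]; rewrite /= ?st //; first by case=> <-.
exact: IH2.
Qed.

Definition holds (P : program) (p : nat) (k : seq instr) :=
  exists pre post, P = pre ++ k ++ post /\ size pre = p.

Lemma holds_catl P p k1 k2 : holds P p (k1 ++ k2) -> holds P p k1.
Proof. by case=> pre [post [-> <-]]; exists pre, (k2 ++ post); rewrite -catA. Qed.

Lemma holds_catr P p k1 k2 :
  holds P p (k1 ++ k2) -> holds P (p + size k1) k2.
Proof.
by case=> pre [post [-> <-]]; exists (pre ++ k1), post; rewrite size_cat !catA.
Qed.

Lemma holds_behead P p i k : holds P p (i :: k) -> holds P p.+1 k.
Proof. by move=> h; rewrite -addn1; apply: (@holds_catr P p [:: i]). Qed.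

Lemma holds_step P p i k : holds P p (i :: k) ->
  p < size P /\ nth (IOut 0) P p = i.
Proof.
case=> pre [post [-> <-]]; rewrite size_cat /= nth_cat ltnn subnn /=.
by split=> //; lia.
Qed.

Lemma reach_step P p i k m o t c' c'' :
  holds P p (i :: k) -> bounded m ->
  match i with
  | IConst d v => Config p.+1 (upd m d v) o
  | IBin op d a b => Config p.+1 (upd m d (eval_binop op (m a) (m b))) o
  | ILoad d a => Config p.+1 (upd m d (m (m a))) o
  | IStore a s => Config p.+1 (upd m (m a) (m s)) o
  | IRead d a => Config p.+1 (upd m d (nth 0 inp (m a))) o
  | IJz a t => Config (if m a == 0 then t else p.+1) m o
  | IOut a => Config p.+1 m (rcons o (m a))
  end = c' ->
  reach P t c' c'' -> reach P t.+1 (Config p m o) c''.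
Proof.
move=> /holds_step[lt nthE] bm <- r; apply: reachS r => //=.
by rewrite lt nthE; case: (i).
Qed.

Definition rep (m : nat -> nat) (s : nat -> nat -> nat) :=
  bounded m /\ forall a i, a < 15 -> m (addr a i) = s a i /\ s a i <= V.

(** Code at level [k] may change only the temporaries from [k] on: array cells and the partial
    results of lower levels survive. *)
Definition agree (k : nat) (m m' : nat -> nat) :=
  forall x, (x %% 16 != 0) || (x < temp k) -> m' x = m x.

Lemma agree_le k k' m m' : k <= k' -> agree k' m m' -> agree k m m'.
Proof.
move=> kk a x hx; rewrite a //.
by case/orP: hx => [->//|hx]; apply/orP; right; rewrite /temp in hx *; lia.
Qed.

Lemma agree_trans k m1 m2 m3 : agree k m1 m2 -> agree k m2 m3 -> agree k m1 m3.
Proof. by move=> a12 a23 x hx; rewrite a23 ?a12. Qed.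

Lemma agree_upd k k' m v : k <= k' -> agree k m (upd m (temp k') v).
Proof.
move=> kk x hx; rewrite /upd; case: eqP => // xE; move: hx.
by rewrite xE /temp; lia.
Qed.

Lemma bounded_upd m x v : bounded m -> v <= bound -> bounded (upd m x v).
Proof. by move=> bm hv y; rewrite /upd; case: ifP. Qed.

Lemma addr_ntemp a i : a < 15 -> addr a i %% 16 != 0.
Proof. by rewrite /addr; lia. Qed.

Lemma rep_agree k m m' s : rep m s -> agree k m m' -> bounded m' -> rep m' s.
Proof.
move=> [bm h] ag bm'; split=> // a i a15; case: (h a i a15) => <- sle.
by rewrite ag ?addr_ntemp.
Qed.

Lemma expn_pos z : 0 < z -> V <= V ^ z.
Proof. by case: z => // z _; rewrite expnS leq_pmulr // expn_gt0; lia. Qed.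

Lemma expn_bound z : z <= 21 -> V ^ z <= bound.
Proof. by move=> zle; apply: leq_pexp2l => //; lia. Qed.

Lemma V_bound : V <= bound.
Proof. exact: expn_pos. Qed.

(** Since [A] and [B] are at least 2, [A + B <= A * B], so a product bounds every operator; this is
    why [esize] adds the exponents of both operands. *)
Lemma eval_binop_le o a b A B : 2 <= A -> 2 <= B -> a <= A -> b <= B ->
  eval_binop o a b <= A * B.
Proof.
move=> A2 B2 aA bB; have ab : A + B <= A * B by nia.
case: o => /=.
- by lia.
- by lia.
- exact: leq_mul.
- by apply: (leq_trans (leq_div a b)); nia.
- by apply: (leq_trans (leq_mod a b)); nia.
- by case: (a < b); lia.
- by case: (a == b); lia.
Qed.

Lemma esize_gt0 e : 0 < esize e.
Proof. by elim: e => //= o e1 h1 e2 h2; lia. Qed.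

Lemma eval_le e (s : nat -> nat -> nat) :
  (forall a i, a < 15 -> s a i <= V) ->
  wf_expr e -> eval inp s e <= V ^ esize e.
Proof.
move=> sle; elim: e => [v|a e IH|o e1 IH1 e2 IH2|e IH] /=.
- by rewrite expn1; lia.
- by case/andP=> a15 _; apply: leq_trans (expn_pos _); first exact: sle.
- case/andP=> /IH1 h1 /IH2 h2; rewrite expnD.
  have h z : 0 < z -> 2 <= V ^ z by move/expn_pos; lia.
  by apply: eval_binop_le; rewrite ?h ?esize_gt0.
- by move=> _; apply: leq_trans (inp_le _) _; apply/expn_pos/esize_gt0.
Qed.

(** An index of size at most [V ^ z] has an address at most [16 * V ^ z + 16 <= V ^ z.+1], because
    [V] is at least 32. This is the factor that [esize] adds at each [Cell]. *)
Lemma addr_code_reach P p k a m o z :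
  holds P p (addr_code k a) -> bounded m -> a < 15 -> z < 21 ->
  m (temp k) <= V ^ z ->
  exists m', [/\ reach P 4 (Config p m o) (Config (p + 4) m' o),
    m' (temp k) = addr a (m (temp k)) & agree k m m'].
Proof.
move=> hP bm a15 zle mle.
have neq' : (temp k == temp k.+1) = false by rewrite /temp; lia.
have le0 : 32 <= bound by exact: leq_trans V_ge V_bound.
have le1 : 16 * m (temp k) + 16 <= bound.
  have: V ^ z.+1 <= bound by exact: expn_bound.
  have: 0 < V ^ z by rewrite expn_gt0; lia.
  by rewrite expnS; nia.
set m1 := upd m (temp k.+1) 16.
set m2 := upd m1 (temp k) (m (temp k) * 16).
set m3 := upd m2 (temp k.+1) a.+1.
set m4 := upd m3 (temp k) (m (temp k) * 16 + a.+1).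
have b1 : bounded m1 by apply: bounded_upd => //; lia.
have b2 : bounded m2 by apply: bounded_upd => //; lia.
have b3 : bounded m3 by apply: bounded_upd => //; lia.
have b4 : bounded m4 by apply: bounded_upd => //; lia.
exists m4; split.
- rewrite -!addSnnS addn0.
  apply: (reach_step hP bm (erefl _)); move/holds_behead: hP => hP.
  have E2 : m2 = upd m1 (temp k) (m1 (temp k) * m1 (temp k.+1)).
    by rewrite /m2 /m1 /upd !eqxx neq'.
  apply: (reach_step hP b1 (erefl _)); rewrite /= -E2.
  move/holds_behead: hP => hP.
  apply: (reach_step hP b2 (erefl _)); move/holds_behead: hP => hP.
  have E4 : m4 = upd m3 (temp k) (m3 (temp k) + m3 (temp k.+1)).
    by rewrite /m4 /m3 /m2 /upd !eqxx neq'.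
  by apply: (reach_step hP b3 (erefl _)); rewrite /= -E4; apply: reach0.
- by rewrite /m4 /upd eqxx /addr mulnC.
- move=> x hx; rewrite /m4 /m3 /m2 /m1 /upd.
  have -> : (x == temp k.+1) = false.
    by apply/eqP => xE; move: hx; rewrite xE /temp; lia.
  have -> // : (x == temp k) = false.
  by apply/eqP => xE; move: hx; rewrite xE /temp; lia.
Qed.

(** Induction on [e] for all levels: a left operand survives in [temp k] because the right one is
    evaluated at level [k.+1], which leaves lower temporaries alone. *)
Lemma expr_code_reach P e : forall p k m s o,
  holds P p (expr_code k e) -> rep m s -> wf_expr e -> esize e <= 20 ->
  exists m', [/\ reach P (size (expr_code k e)) (Config p m o)
      (Config (p + size (expr_code k e)) m' o),
    m' (temp k) = eval inp s e & agree k m m'].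
Proof.
elim: e => [v|a e IH|op e1 IH1 e2 IH2|e IH] p k m s o /= hP hr.
- move=> v32 _; have vB : v <= bound.
    by apply: leq_trans V_bound; lia.
  exists (upd m (temp k) v); split; last exact: agree_upd.
    apply: (reach_step hP hr.1 (erefl _)); rewrite addn1.
    by apply: reach0; apply: bounded_upd hr.1 _.
  by rewrite /upd eqxx.
- case/andP=> a15 wf es.
  have [m1 [r1 v1 a1]] := IH _ _ _ _ o (holds_catl hP) hr wf (ltnW es).
  have hr1 := rep_agree hr a1 (reach_bounded r1).
  have {}hP := holds_catr hP.
  have ele : m1 (temp k) <= V ^ esize e.
    by rewrite v1; apply: eval_le => // b i b15; case: hr => _ h; case: (h b i b15).
  have [m2 [r2 v2 a2]] := addr_code_reach o
     (@holds_catl P _ (addr_code k a) [:: ILoad (temp k) (temp k)] hP) hr1.1 a15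
     (leq_trans es (leqnSn _)) ele.
  have hr2 := rep_agree hr1 a2 (reach_bounded r2).
  have {}hP := @holds_catr P _ (addr_code k a) [:: ILoad (temp k) (temp k)] hP.
  have [me sle] := hr2.2 a (eval inp s e) a15.
  exists (upd m2 (temp k) (s a (eval inp s e))); split.
  + rewrite size_cat /= -[5]/(4 + 1) !addnA.
    apply: reach_trans; first apply: reach_trans; [exact: r1|exact: r2|].
    apply: (reach_step hP hr2.1 (erefl _)); rewrite /= v2 v1 me addn1.
    apply: reach0; apply: bounded_upd hr2.1 _.
    exact: leq_trans sle V_bound.
  + by rewrite /upd eqxx.
  + apply: (agree_trans a1); apply: (agree_trans a2).
    exact: agree_upd.
- case/andP=> w1 w2 es.
  have [g1 g2] := (esize_gt0 e1, esize_gt0 e2).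
  have es1 : esize e1 <= 20 by lia.
  have es2 : esize e2 <= 20 by lia.
  have [m1 [r1 v1 a1]] := IH1 _ _ _ _ o (holds_catl hP) hr w1 es1.
  have hr1 := rep_agree hr a1 (reach_bounded r1).
  move/holds_catr: hP => hP.
  have [m2 [r2 v2 a2]] := IH2 _ _ _ _ o (holds_catl hP) hr1 w2 es2.
  have hr2 := rep_agree hr1 a2 (reach_bounded r2).
  move/holds_catr: hP => /= hP.
  set x := eval_binop _ _ _.
  exists (upd m2 (temp k) x); split.
  + rewrite !size_cat /= !addnA.
    apply: reach_trans; first apply: reach_trans; [exact: r1|exact: r2|].
    apply: (reach_step hP hr2.1 (erefl _)); rewrite /= v2 a2 ?v1 ?addn1; last first.
      by rewrite /temp; lia.
    apply: reach0; apply: bounded_upd hr2.1 _.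
    apply: (@leq_trans (V ^ esize (Bin op e1 e2))); last by apply: expn_bound => /=; lia.
    apply: (@eval_le (Bin op e1 e2)) => /=; last by rewrite w1.
    by move=> b i b15; case: hr => _ h; case: (h b i b15).
  + by rewrite /upd eqxx.
  + apply: (agree_trans a1); apply: (agree_trans (agree_le (leqnSn k) a2)).
    exact: agree_upd.
- move=> wf es.
  have [m1 [r1 v1 a1]] := IH _ _ _ _ o (holds_catl hP) hr wf es.
  have hr1 := rep_agree hr a1 (reach_bounded r1).
  move/holds_catr: hP => /= hP.
  exists (upd m1 (temp k) (nth 0 inp (eval inp s e))); split.
  + rewrite !size_cat /= !addnA; apply: reach_trans r1 _.
    apply: (reach_step hP hr1.1 (erefl _)); rewrite /= v1 addn1.
    apply: reach0; apply: bounded_upd hr1.1 _.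
    exact: leq_trans (inp_le _) V_bound.
  + by rewrite /upd eqxx.
  + by apply: (agree_trans a1); exact: agree_upd.
Qed.

(* Every primitive command, and every test of a loop or a conditional, is
   charged one unit of [clock], which pays for [unit_cost] machine steps. *)
Definition unit_cost := 100.

(** Total correctness from one start state, for the code at any place of any program; the increase
    of [clock] pays for the machine steps. Well-formedness is a premise, so that it can be checked
    once, by computation, for the whole program. *)
Definition triple (c : cmd) (s : state) (Q : state -> Prop) : Prop :=
  wf_cmd c -> forall P p m, holds P p (cmd_code p c) -> rep m (cell s) ->
  exists t m' s',
    [/\ reach P t (Config p m (outp s))
          (Config (p + size (cmd_code p c)) m' (outp s')),
        rep m' (cell s'), t + unit_cost * clock s <= unit_cost * clock s' & Q s'].

(** Loops have no precondition by recursion on the syntax, so [wp] falls back on [triple] there, to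
    be proved with an invariant. *)
Fixpoint wp (c : cmd) (Q : state -> Prop) (s : state) : Prop :=
  match c with
  | Store a e1 e2 =>
      eval inp (cell s) e2 <= V /\
      Q (write s a (eval inp (cell s) e1) (eval inp (cell s) e2))
  | Print e => Q (print s (eval inp (cell s) e))
  | Seq c1 c2 => wp c1 (wp c2 Q) s
  | If e c =>
      if eval inp (cell s) e == 0 then Q (tick s) else wp c Q (tick s)
  | While e c => triple (While e c) s Q
  end.

Lemma addr_inj a b i j : a < 15 -> b < 15 ->
  (addr b j == addr a i) = (b == a) && (j == i).
Proof.
rewrite /addr => a15 b15; apply/eqP/andP => [h|[/eqP-> /eqP->] //].
by split; apply/eqP; lia.
Qed.

Lemma rep_setc m s a i v : a < 15 -> rep m s -> v <= V ->
  rep (upd m (addr a i) v) (setc s a i v).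
Proof.
move=> a15 [bm h] vV; split; first exact: bounded_upd (leq_trans vV V_bound).
move=> b j b15; rewrite /upd /setc addr_inj //.
by case: ifP => // _; exact: h.
Qed.

Lemma small_expr_reach P p e k m s o :
  holds P p (expr_code k e) -> rep m s -> small_expr e ->
  exists m', [/\ reach P (size (expr_code k e)) (Config p m o)
      (Config (p + size (expr_code k e)) m' o),
    m' (temp k) = eval inp s e, agree k m m' & rep m' s].
Proof.
move=> hP hr /and3P[wf es _].
have [m' [r v a]] := expr_code_reach o hP hr wf es.
by exists m'; split=> //; apply: rep_agree a (reach_bounded r).
Qed.

Lemma triple_store a e1 e2 s (Q : state -> Prop) :
  eval inp (cell s) e2 <= V ->
  Q (write s a (eval inp (cell s) e1) (eval inp (cell s) e2)) ->
  triple (Store a e1 e2) s Q.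
Proof.
move=> vV HQ /and4P[a15 se1 se2 sz] P p m /= hP hr.
have [m1 [r1 v1 _ hr1]] := small_expr_reach (outp s) (holds_catl hP) hr se1.
have {}hP := holds_catr hP.
have hPa := @holds_catl P _ (addr_code 0 a) (expr_code 1 e2 ++ [:: IStore (temp 0) (temp 1)]) hP.
have {}hP := @holds_catr P _ (addr_code 0 a) (expr_code 1 e2 ++ [:: IStore (temp 0) (temp 1)]) hP.
have [w1 es1] : wf_expr e1 /\ esize e1 <= 20 by case/and3P: se1.
have ele : m1 (temp 0) <= V ^ esize e1.
  by rewrite v1; apply: eval_le => // b i b15; case: hr => _ h; case: (h b i b15).
have [m2 [r2 v2 a2]] := addr_code_reach (outp s) hPa hr1.1 a15 es1 ele.
have hr2 := rep_agree hr1 a2 (reach_bounded r2).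
have [m3 [r3 v3 a3 hr3]] := small_expr_reach (outp s) (holds_catl hP) hr2 se2.
have {}hP := holds_catr hP.
have m3E : m3 (temp 0) = addr a (eval inp (cell s) e1) by rewrite a3 // v2 v1.
have hr4 := rep_setc (eval inp (cell s) e1) a15 hr3 vV.
exists (size (expr_code 0 e1) + 4 + size (expr_code 1 e2) + 1).
exists (upd m3 (addr a (eval inp (cell s) e1)) (eval inp (cell s) e2)).
exists (write s a (eval inp (cell s) e1) (eval inp (cell s) e2)); split=> //=.
- have -> : p + size (expr_code 0 e1 ++ addr_code 0 a ++ expr_code 1 e2 ++
      [:: IStore (temp 0) (temp 1)]) =
      (p + size (expr_code 0 e1) + 4 + size (expr_code 1 e2)).+1.
    by rewrite !size_cat /=; lia.
  apply: (reach_trans (reach_trans (reach_trans r1 r2) r3)).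
  apply: (reach_step hP hr3.1 (erefl _)); rewrite /= m3E v3.
  by apply: reach0; exact: hr4.1.
- by rewrite /unit_cost mulnS; lia.
Qed.

Lemma triple_print e s (Q : state -> Prop) :
  Q (print s (eval inp (cell s) e)) -> triple (Print e) s Q.
Proof.
move=> HQ wf P p m /= hP hr.
have [m1 [r1 v1 _ hr1]] := small_expr_reach (outp s) (holds_catl hP) hr wf.
have {}hP := holds_catr hP; case/and3P: wf => _ _ sz.
exists (size (expr_code 0 e) + 1), m1, (print s (eval inp (cell s) e)); split=> //=.
  rewrite size_cat addnA; apply: (reach_trans r1).
  apply: (reach_step hP hr1.1 (erefl _)); rewrite v1 /= addn1.
  apply: reach0; exact: hr1.1.
by rewrite /unit_cost mulnS; lia.
Qed.

Lemma triple_seq c1 c2 s (R Q : state -> Prop) :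
  triple c1 s R -> (forall s', R s' -> triple c2 s' Q) -> triple (Seq c1 c2) s Q.
Proof.
move=> h1 h2 /andP[wf1 wf2] P p m /= hP hr.
have [t1 [m1 [s1 [r1 hr1 le1 /h2 h]]]] := h1 wf1 _ _ _ (holds_catl hP) hr.
have [t2 [m2 [s2 [r2 hr2 le2 HQ]]]] := h wf2 _ _ _ (holds_catr hP) hr1.
exists (t1 + t2), m2, s2; split=> //; last by lia.
by rewrite size_cat addnA; apply: reach_trans r1 r2.
Qed.

Lemma triple_if e c s (Q : state -> Prop) :
  (if eval inp (cell s) e == 0 then Q (tick s) else triple c (tick s) Q) ->
  triple (If e c) s Q.
Proof.
move=> HQ /andP[se wf] P p m hP hr; move: hP => /=.
set k := cmd_code _ c => hP.
have -> : p + size (expr_code 0 e ++ IJz (temp 0)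
    (p + (size (expr_code 0 e)).+1 + size k) :: k) =
    p + (size (expr_code 0 e)).+1 + size k.
  by rewrite size_cat /=; lia.
have [m1 [r1 v1 _ hr1]] := small_expr_reach (outp s) (holds_catl hP) hr se.
have {}hP := holds_catr hP; case/and3P: se => _ _ sz.
case: ifP HQ => [e0 HQ|e0 /(_ wf) HQ].
  exists (size (expr_code 0 e) + 1), m1, (tick s); split=> //=.
    apply: (reach_trans r1); apply: (reach_step hP hr1.1 (erefl _)).
    by rewrite v1 e0; apply: reach0; exact: hr1.1.
  by rewrite /unit_cost mulnS; lia.
have hP' := holds_behead hP; rewrite -addnS in hP'.
have [t2 [m2 [s2 [r2 hr2 le2 HQ2]]]] := HQ _ _ _ hP' hr1.
exists (size (expr_code 0 e) + t2.+1), m2, s2; split=> //.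
  apply: (reach_trans r1); apply: (reach_step hP hr1.1 (erefl _)).
  by rewrite v1 e0 -addnS.
by move: le2; rewrite /unit_cost /= mulnS; lia.
Qed.

Lemma triple_while_unfold e c s (Q : state -> Prop) :
  (if eval inp (cell s) e == 0 then Q (tick s) else
   triple c (tick s) (fun s' => triple (While e c) s' Q)) ->
  triple (While e c) s Q.
Proof.
move=> HQ wfw P p m hP0 hr; move: (wfw) (hP0) => /andP[se wf] /=.
set k := cmd_code _ c => hP.
have pE : p + size (cmd_code p (While e c)) =
    p + (size (expr_code 0 e)).+1 + size k + 2.
  by rewrite /= -/k size_cat /= size_cat /=; lia.
have [m1 [r1 v1 _ hr1]] := small_expr_reach (outp s) (holds_catl hP) hr se.
have {}hP := holds_catr hP; case/and3P: (se) => _ _ sz.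
case: ifP HQ => [e0 HQ|e0 /(_ wf) HQ].
  exists (size (expr_code 0 e) + 1), m1, (tick s); split=> //.
    apply: (reach_trans r1); apply: (reach_step hP hr1.1 (erefl _)).
    by rewrite v1 e0 pE; apply: reach0; exact: hr1.1.
  by rewrite /unit_cost /= mulnS; lia.
have hP' := holds_behead hP; rewrite -addnS in hP'.
have [t2 [m2 [s2 [r2 hr2 le2 HQ2]]]] := HQ _ _ _ (holds_catl hP') hr1.
have {}hP' := holds_catr hP'; have hP'' := holds_behead hP'.
(* The jump back overwrites only [temp 0], which is invisible to [rep]; its two instructions are
   paid by the clock unit of the test. *)
have b3 : bounded (upd m2 (temp 0) 0) by apply: bounded_upd hr2.1 _.
have hr3 := rep_agree hr2 (agree_upd m2 0 (leqnn 0)) b3.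
have [t3 [m3 [s3 [r3 hr3' le3 HQ3]]]] := HQ2 wfw _ _ _ hP0 hr3.
exists (size (expr_code 0 e) + (t2 + t3.+2).+1), m3, s3; split=> //.
  apply: (reach_trans r1); apply: (reach_step hP hr1.1 (erefl _)).
  rewrite v1 e0 -addnS; apply: (reach_trans r2).
  apply: (reach_step hP' hr2.1 (erefl _)).
  by apply: (reach_step hP'' b3 (erefl _)).
by move: le2 le3; rewrite /unit_cost /= mulnS; lia.
Qed.

Lemma triple_weaken c s (Q R : state -> Prop) :
  (forall s', Q s' -> R s') -> triple c s Q -> triple c s R.
Proof.
move=> QR h wf P p m hP hr; have [t [m' [s' [r hr' le HQ]]]] := h wf P p m hP hr.
by exists t, m', s'; split=> //; apply: QR.
Qed.

Lemma wp_sound c : forall s (Q : state -> Prop), wp c Q s -> triple c s Q.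
Proof.
elim: c => [a e1 e2|e|c1 IH1 c2 IH2|e c IH|e c IH] s Q //=.
- by case; apply: triple_store.
- exact: triple_print.
- by move=> /IH1 h; apply: triple_seq h _ => s' /IH2.
- by move=> h; apply: triple_if; case: ifP h => // _ /IH.
Qed.

(** Induction on a bound for the measure [mu]. This rule serves the chain of deletions, whose length
    is not known in advance; the counted loops use the next one. *)
Lemma triple_while (I : state -> Prop) (mu : state -> nat) e c s (Q : state -> Prop) :
  I s ->
  (forall s, I s -> if eval inp (cell s) e == 0 then Q (tick s) else
     wp c (fun s' => I s' /\ mu s' < mu s) (tick s)) ->
  triple (While e c) s Q.
Proof.
move=> Is h; move: {2}(mu s) (leqnn (mu s)) => N; elim: N s Is => [|N IH] s Is le.
  apply: triple_while_unfold; have := h s Is; case: ifP => // _ /wp_sound.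
  by apply: triple_weaken => s' [_]; lia.
apply: triple_while_unfold; have := h s Is; case: ifP => // _ /wp_sound.
by apply: triple_weaken => s' [Is' lt]; apply: IH => //; lia.
Qed.

Lemma triple_for N (I : nat -> state -> Prop) e c s (Q : state -> Prop) :
  I 0 s ->
  (forall i s, I i s -> i <= N -> (eval inp (cell s) e == 0) = (i == N)) ->
  (forall i s, I i s -> i < N -> wp c (I i.+1) (tick s)) ->
  (forall s, I N s -> Q (tick s)) ->
  triple (While e c) s Q.
Proof.
move=> I0 test body post.
suff h M i s' : i + M = N -> I i s' -> triple (While e c) s' Q by apply: (h N 0).
elim: M i s' => [|M IH] i s' iE Ii; apply: triple_while_unfold.
  rewrite (test i) //; last by lia.
  have -> : i = N by lia.
  by rewrite eqxx; apply: post; move: Ii; have -> : i = N by lia.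
rewrite (test i) //; last by lia.
case: eqP => [|_]; first by lia.
have /wp_sound := body i s' Ii ltac:(lia).
by apply: triple_weaken => s2 I2; apply: IH I2; lia.
Qed.

Lemma wp_runs c (Q : state -> Prop) : wf_cmd c ->
  wp c Q (State (fun _ _ => 0) [::] 0) ->
  exists t s, [/\ runs (cmd_code 0 c) inp t (outp s) bound,
    t <= unit_cost * clock s & Q s].
Proof.
move=> wf /wp_sound /(_ wf (cmd_code 0 c) 0 (fun _ => 0)) [].
- by exists [::], [::]; rewrite cats0.
- by split=> //; split.
move=> t [m' [s' [r hr le HQ]]]; exists t, s'; split=> //; last first.
  by move: le; rewrite /= muln0 addn0.
have [e b] := reach_exec r; split.
  by move=> i d ile ed a; apply: b ed _.
exists (Config (0 + size (cmd_code 0 c)) m' (outp s')); split=> //.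
by rewrite /step /= add0n ltnn.
Qed.

End Machine.

(** * Forests and the feedback edge number *)

Section Forest.

Variable n : nat.
Implicit Types (E F : {set {set 'I_n}}) (W : {set 'I_n}).

Lemma adj_sym E : symmetric (adj E).
Proof. by move=> x y; rewrite /adj setUC. Qed.

Lemma adj_sub E F x y : E \subset F -> adj E x y -> adj F x y.
Proof. by move=> /subsetP EF; apply: EF. Qed.

Lemma forest_sub E F : E \subset F -> forest F -> forest E.
Proof.
move=> EF /forallP fF; apply/forallP => k; apply/forallP => s.
have /forallP/(_ s) := fF k; apply: contra.
rewrite /is_cycle; case: (tval s) => // x s' /and3P[-> -> /=].
by apply: sub_path => a b; apply: adj_sub.
Qed.

Lemma forestP E : reflect (forall s, ~~ is_cycle E s) (forest E).
Proof.
apply: (iffP idP) => [fE s|h]; last first.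
  by apply/forallP => k; apply/forallP => s; apply: h.
apply/negP => cs.
have us : uniq s by move: cs; case: (s) => // x s' /and3P[].
have ss : size s < n.+1 by rewrite ltnS -(card_uniqP us) -[X in _ <= X]card_ord max_card.
move/forallP: fE => /(_ (Ordinal ss))/forallP/(_ (in_tuple s)).
by rewrite /= cs.
Qed.

(** The first vertex [x] has a neighbour [y] other than its successor on the path. If [y] were on
    the path, the segment from [x] to [y] would close a cycle on at least three vertices, so [y] can
    be put in front. *)
Lemma extend_path_cycle E x s :
  uniq (x :: s) -> path (adj E) x s ->
  (forall v, v \in x :: s -> exists y z, [/\ y != z, adj E v y & adj E v z]) ->
  irreflexive (adj E) ->
  (forall s', ~~ is_cycle E s') ->
  exists y, uniq (y :: x :: s) /\ path (adj E) y (x :: s).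
Proof.
move=> us ps two irr noc.
have [y [ny ay]] : exists y, y != head x s /\ adj E x y.
  have [y [z [yz ay az]]] := two x (mem_head x s).
  case: (eqVneq y (head x s)) => [yh|]; last by exists y.
  by exists z; rewrite -yh eq_sym.
have yx : y != x by apply/eqP => yx; rewrite yx irr in ay.
case: (boolP (y \in x :: s)) => [|nin]; last first.
  by exists y; rewrite cons_uniq nin us /= (adj_sym E y x) ay.
rewrite in_cons (negPf yx) /= => yin; clear two.
case/splitPr: yin us ps ny => s1 s2 us ps ny.
case: s1 us ps ny => [|z s1]; first by rewrite /= eqxx.
rewrite -[y :: s2]cat1s catA cats1 -cat_cons cat_uniq => /and3P[us _ _].
rewrite cat_path => /andP[ps _] _.
have := noc (x :: rcons (z :: s1) y); rewrite /is_cycle us /=.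
rewrite size_rcons /= rcons_path last_rcons (adj_sym E y x) ay.
by move: ps; rewrite /= ?rcons_path andbT => ->.
Qed.

(** Otherwise every vertex of [W] has two neighbours, and paths in [W] can be extended forever, past
    [n] distinct vertices. *)
Lemma forest_low_degree E W : forest E -> W != set0 ->
  (forall e, e \in E -> #|e| = 2 /\ e \subset W) ->
  exists2 v, v \in W & #|[set e in E | v \in e]| <= 1.
Proof.
move=> /forestP fE /set0Pn[w wW] hE.
apply/exists_inP; case: exists_inP => // no; exfalso.
have irr : irreflexive (adj E).
  move=> x; apply/negP => /hE[]; rewrite setUid cards1; lia.
have inW x y : adj E x y -> x \in W.
  by case/hE=> _ /subsetP; apply; rewrite !inE eqxx.
have two v : v \in W -> exists y z, [/\ y != z, adj E v y & adj E v z].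
  move=> vW; have : 1 < #|[set e in E | v \in e]|.
    by rewrite ltnNge; apply/negP => le; apply: no; exists v.
  case/card_gt1P=> e [f [] ]; rewrite !inE => /andP[eE ve] /andP[fF vf] ef.
  have nb g : g \in E -> v \in g -> exists y, g = [set v; y].
    move=> /hE[/eqP/cards2P[a [b [ab ->]]] _]; rewrite !inE => /orP[]/eqP->.
      by exists b.
    by exists a; rewrite setUC.
  have [y yE] := nb e eE ve; have [z zE] := nb f fF vf.
  exists y, z; rewrite /adj -yE -zE; split=> //.
  by apply: contraNneq ef => yz; rewrite yE zE yz.
have long k : exists x s, [/\ uniq (x :: s), path (adj E) x s, size s = k
    & {subset x :: s <= W}].
  elim: k => [|k [x [s [us ps ss sW]]]].
    by exists w, [::]; split=> // v; rewrite inE => /eqP->.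
  have [|y [uy py]] := extend_path_cycle us ps _ irr fE; first by move=> v /sW/two.
  exists y, (x :: s); split=> //=; first by rewrite ss.
  move=> v; rewrite in_cons => /orP[/eqP->|/sW //].
  by apply: (@inW y x); move: py => /= /andP[].
have [x [s [us _ ss _]]] := long n.
have := max_card (mem (x :: s)); rewrite (card_uniqP us) card_ord /= ss; lia.
Qed.

(** Induction on [#|W|]: removing a vertex of degree at most one costs at most one edge. The weaker
    bound [#|W|] in place of [#|W| - 1] makes the empty set a valid base case. *)
Lemma forest_card E W : forest E ->
  (forall e, e \in E -> #|e| = 2 /\ e \subset W) -> #|E| <= #|W|.
Proof.
elim: {W}_.+1 {-2}W (ltnSn #|W|) E => // N IH W Wle E fE hE.
case: (eqVneq W set0) => [W0|Wn0].
  rewrite (_ : E = set0) ?cards0 //; apply/setP => e; rewrite inE.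
  apply/negP => /hE[]; rewrite W0 subset0 => c2 /eqP e0.
  by rewrite e0 cards0 in c2.
have [v vW dv] := forest_low_degree fE Wn0 hE.
rewrite (cardsD1 v W) vW in Wle *.
rewrite -(cardsID [set e : {set 'I_n} | v \in e] E).
have -> : E :&: [set e : {set 'I_n} | v \in e] = [set e in E | v \in e].
  by apply/setP => e; rewrite !inE.
apply: leq_add dv _; apply: IH; first by lia.
  by apply: forest_sub fE; apply: subsetDl.
move=> e; rewrite !inE => /andP[ve /hE[c2 eW]]; split=> //.
apply/subsetP => x xe; rewrite !inE (subsetP eW) // andbT.
by apply: contraNneq ve => <-.
Qed.

(** The minimum is attained; its default value [#|E|] is attained by removing all edges. *)
Lemma feedback_edge_set E : exists F : {set {set 'I_n}},
  forest (E :\: F) /\ #|F| = feedback_edge_number E.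
Proof.
rewrite /feedback_edge_number; elim/big_ind: _ => [|x y [F1 [f1 <-]] [F2 [f2 <-]]|F].
- exists E; split=> //; rewrite setDv; apply/forestP => -[|x [|y s]] //=.
  by apply/negP => /and3P[_ _ /andP[]]; rewrite /adj inE.
- by rewrite /minn; case: ifP => _; [exists F1|exists F2].
- by case/andP=> _ fF; exists F.
Qed.

(** Split [E'] along a minimum feedback edge set of [E]: the part outside it is a forest on [W]. *)
Lemma card_edges_le E E' W : E' \subset E ->
  (forall e, e \in E' -> #|e| = 2 /\ e \subset W) ->
  #|E'| <= #|W| + feedback_edge_number E.
Proof.
move=> EE hE; have [F [fF <-]] := feedback_edge_set E.
rewrite -(cardsID F E') addnC leq_add //; last exact/subset_leq_card/subsetIr.
apply: forest_card; first by apply: forest_sub fF; apply: setSD.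
by move=> e; rewrite inE => /andP[_ /hE].
Qed.

End Forest.

(** * Degrees, peeling and orientation of edge lists *)

Section EdgeLists.

Implicit Types (e : nat * nat) (es fs os : seq (nat * nat)) (u v w : nat).

Definition touch v e := (e.1 == v) || (e.2 == v).
(** For an edge with distinct ends this is the other end if [v] is an end, and 0 otherwise; so
    [nsum] below adds up the neighbours of [v]. *)
Definition opposite v e := (e.1 == v) * e.2 + (e.2 == v) * e.1.
Definition deg fs v := count (touch v) fs.
Definition nsum fs v := \sum_(e <- fs) opposite v e.
Definition linked fs u v := ((u, v) \in fs) || ((v, u) \in fs).
Definition unordered e := (minn e.1 e.2, maxn e.1 e.2).

Definition simple n fs :=
  all (fun e => [&& e.1 < n, e.2 < n & e.1 != e.2]) fs && uniq (map unordered fs).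

Definition induced (a : pred nat) fs := [seq e <- fs | a e.1 && a e.2].

Lemma simple_mem n fs e : simple n fs -> e \in fs ->
  [/\ e.1 < n, e.2 < n & e.1 <> e.2].
Proof. by case/andP=> /allP h _ /h/and3P[-> -> /eqP]. Qed.

Lemma simple_subseq n gs fs : subseq gs fs -> simple n fs -> simple n gs.
Proof.
move=> sub /andP[h u]; apply/andP; split; last exact: subseq_uniq (map_subseq _ sub) u.
by apply/allP => e /(mem_subseq sub) /(allP h).
Qed.

Lemma simple_induced n a fs : simple n fs -> simple n (induced a fs).
Proof. exact/simple_subseq/filter_subseq. Qed.

Lemma deg_dead a fs v : ~~ a v -> deg (induced a fs) v = 0.
Proof.
move=> av; apply/eqP; rewrite -leqn0 leqNgt -has_count; apply/hasPn => e.
rewrite mem_filter => /andP[/andP[a1 a2] _]; apply/norP.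
by split; apply: contraNneq av => <-.
Qed.

Lemma deg_gt0 fs e v : e \in fs -> touch v e -> 0 < deg fs v.
Proof. by move=> efs te; rewrite -has_count; apply/hasP; exists e. Qed.

Lemma nsum_le n fs v : simple n fs -> nsum fs v <= n * size fs.
Proof.
case/andP=> h _; rewrite /nsum.
elim: fs h => [|e fs IH] /=; first by rewrite big_nil.
case/andP=> /and3P[e1 e2 ne] /IH le; rewrite big_cons mulnS.
by apply: leq_add le; rewrite /opposite; move: ne; do 3![case: eqP => ?] => //=; lia.
Qed.

Lemma deg_le fs v : deg fs v <= size fs.
Proof. exact: count_size. Qed.

Lemma nsum_rcons fs e v : nsum (rcons fs e) v = nsum fs v + opposite v e.
Proof. by rewrite /nsum -cats1 big_cat big_seq1. Qed.

Lemma deg_rcons fs e v : deg (rcons fs e) v = deg fs v + touch v e.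
Proof. by rewrite /deg -cats1 count_cat /= addn0. Qed.

(** Handshake lemma: each edge contributes to two distinct vertices below [n]. *)
Lemma sum_deg n fs : simple n fs -> \sum_(0 <= v < n) deg fs v = 2 * size fs.
Proof.
case/andP=> h _; elim: fs h => [|e fs IH] /=.
  by rewrite big1_eq.
case/andP=> /and3P[e1 e2 ne] /IH le; rewrite big_split /= {}le mulnS; congr (_ + _).
transitivity (\sum_(0 <= v < n) ((v == e.1) + (v == e.2))).
  apply: eq_bigr => v _; rewrite /touch ![_ == v]eq_sym.
  by move/eqP: ne; do 2!case: eqP => //= ?; lia.
have one a : a < n -> \sum_(0 <= v < n) (v == a) = 1.
  move=> an; rewrite big_mkord (bigD1 (Ordinal an)) //= eqxx big1 // => i.
  by rewrite -val_eqE /= => /negPf ->.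
by rewrite big_split /= !one.
Qed.

(** * Deleting a vertex of degree one *)

Section Peel.

Variables (n : nat) (fs : seq (nat * nat)) (w : nat).
Hypotheses (fsP : simple n fs) (dw : deg fs w = 1).
Let fs' := [seq e <- fs | ~~ touch w e].

Lemma leaf_edge : exists e, [/\ e \in fs, touch w e & forall p : pred (nat * nat),
  count p fs = p e + count p fs'] /\ forall v, nsum fs v = opposite v e + nsum fs' v.
Proof.
have pf : perm_eq ([seq e <- fs | touch w e] ++ fs') fs by rewrite perm_filterC.
have : size [seq e <- fs | touch w e] = 1 by rewrite size_filter -/(deg fs w) dw.
case E: [seq e <- fs | touch w e] pf => [|e [|]] //= pf _.
have : e \in [seq e <- fs | touch w e] by rewrite E mem_head.
rewrite mem_filter => /andP[te efs]; exists e; split.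
  by split=> // p; rewrite -(permP pf).
by move=> v; rewrite /nsum -(perm_big _ pf) big_cons.
Qed.

(** The sum at a leaf [w] has a single term, so it is the neighbour [u] itself. Only the entries of
    [w] and [u] change, and these changes are exactly the assignments in [peel_body]. *)
Lemma leaf_peel : let u := nsum fs w in [/\ u < n, u != w,
  forall v, deg fs' v = if v == w then 0 else deg fs v - (v == u) &
  forall v, nsum fs' v = if v == w then 0 else nsum fs v - (v == u) * w].
Proof.
have [e [[efs te dE] sE]] := leaf_edge.
have [e1 e2 /eqP ne] := simple_mem fsP efs.
have s0 : nsum fs' w = 0.
  rewrite /nsum big_seq big1 // => f; rewrite mem_filter /touch /opposite.
  by case/andP=> /norP[/negPf-> /negPf->].
have d0 : deg fs' w = 0.
  by apply/eqP; rewrite -leqn0 leqNgt -has_count; apply/hasPn => f;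
    rewrite mem_filter => /andP[].
have uE : nsum fs w = if e.1 == w then e.2 else e.1.
  rewrite sE s0 addn0 /opposite; move: te ne; rewrite /touch.
  by do 2!case: eqP => ? //=; lia.
rewrite /= uE; split.
- by case: ifP.
- move: te ne; rewrite /touch; do 2!case: eqP => //= ?; rewrite eq_sym; lia.
- move=> v; case: (eqVneq v w) => [->//|vw].
  have wv : (w == v) = false by rewrite eq_sym (negPf vw).
  rewrite /deg dE; move: te; rewrite /touch (eq_sym v).
  by case: (eqVneq e.1 w) => [->|_ /eqP->]; rewrite wv ?orbF /= addKn.
- move=> v; case: (eqVneq v w) => [->//|vw].
  have wv : (w == v) = false by rewrite eq_sym (negPf vw).
  rewrite sE; move: te; rewrite /touch /opposite (eq_sym v).
  by case: (eqVneq e.1 w) => [->|_ /eqP->]; rewrite wv ?mul0n ?add0n ?addn0 addKn.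
Qed.

Lemma leaf_uniq e1 e2 : e1 \in fs -> e2 \in fs -> touch w e1 -> touch w e2 -> e1 = e2.
Proof.
have [e [[efs te dE] _]] := leaf_edge.
have h f : f \in fs -> touch w f -> e = f.
  move=> ffs tf; have : 0 < count_mem f fs by rewrite -has_count has_pred1.
  rewrite dE /= (count_memPn _) ?mem_filter ?tf //.
  by case: (eqVneq e f).
by move=> h1 h2 t1 t2; rewrite -(h e1) // (h e2).
Qed.

End Peel.

(** The peeling invariant: [a] contains every corner of every triangle. Naming one corner suffices,
    as the premises are symmetric in the corners. *)
Definition triangle_alive es (a : pred nat) := forall x y z,
  linked es x y -> linked es y z -> linked es x z -> a x.

Lemma linkedC gs x y : linked gs x y = linked gs y x.
Proof. by rewrite /linked orbC. Qed.

Definition remove (a : pred nat) w : pred nat := fun v => a v && (v != w).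

Lemma induced_remove a es w :
  induced (remove a w) es = [seq e <- induced a es | ~~ touch w e].
Proof.
rewrite /induced -filter_predI; apply: eq_filter => e /=.
by rewrite /remove /touch negb_or andbACA andbC.
Qed.

(** If [w] were a corner of a triangle [w y z], both edges at [w] would still be present. As [w] has
    degree one they would coincide, which forces a loop. *)
Lemma triangle_alive_remove n es a w : simple n es -> triangle_alive es a ->
  deg (induced a es) w = 1 -> triangle_alive es (remove a w).
Proof.
move=> esP ta dw x y z xy yz xz; rewrite /remove (ta x y z) //=.
apply/eqP => xw; rewrite {x}xw in xy xz.
have aw := ta _ _ _ xy yz xz.
have ay : a y by apply: (ta y w z) => //; rewrite linkedC.
have az : a z by apply: (ta z w y); rewrite linkedC // linkedC.
have irr v : ~~ linked es v v.
  by apply/negP => /orP[] /(simple_mem esP)[].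
have edge v : a v -> linked es w v ->
    exists e, [/\ e \in induced a es, touch w e & e = (w, v) \/ e = (v, w)].
  move=> av /orP[] h; [exists (w, v) | exists (v, w)]; split; auto;
  by rewrite ?mem_filter /= ?aw ?av ?h // /touch /= eqxx ?orbT.
have [e [ein te eE]] := edge y ay xy; have [f [fin tf fE]] := edge z az xz.
have ef := leaf_uniq dw ein fin te tf; move: eE fE; rewrite ef.
case=> ->; case=> -[].
- by move=> yz'; move: yz; rewrite yz' (negPf (irr _)).
- by move=> wz _; move: xz; rewrite wz (negPf (irr _)).
- by move=> yw _; move: xy; rewrite yw (negPf (irr _)).
- by move=> yz'; move: yz; rewrite yz' (negPf (irr _)).
Qed.

(** * Orientation by degree and the resulting list of triangles *)

Section Orientation.

Variables (n : nat) (d : nat -> nat).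

(** For vertices below [n] this encodes the lexicographic order on the pairs [(d v, v)] in one
    number. *)
Definition key v := d v * n + v.

Lemma key_inj u v : u < n -> v < n -> key u = key v -> u = v.
Proof.
move=> un vn /(congr1 (modn^~ n)); rewrite /key !modnMDl !modn_small //.
Qed.

Lemma key_deg u v : u < n -> v < n -> key u < key v -> d u <= d v.
Proof. by rewrite /key; nia. Qed.

Definition orient e :=
  if key e.2 < key e.1 then (e.2, e.1) else e.

Definition succs os u := [seq e.2 | e <- os & e.1 == u].

Lemma mem_succs os u v : (v \in succs os u) = ((u, v) \in os).
Proof.
apply/mapP/idP => [[[a b]]|h]; last by exists (u, v); rewrite ?mem_filter ?eqxx.
by rewrite mem_filter /= => /andP[/eqP-> h] ->.
Qed.

Lemma succs_rcons os e u :
  succs (rcons os e) u = if e.1 == u then rcons (succs os u) e.2 else succs os u.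
Proof. by rewrite /succs filter_rcons; case: ifP => // _; rewrite map_rcons. Qed.

Variable fs : seq (nat * nat).
Hypothesis fsP : simple n fs.
Let os := map orient fs.

Lemma orient_mem u v :
  ((u, v) \in os) = (linked fs u v) && (key u < key v).
Proof.
apply/mapP/idP => [[[a b] efs]|/andP[/orP[] h lt]].
- have [/= an bn ne] := simple_mem fsP efs; rewrite /orient /= /linked.
  case: ifP => [lt [-> ->]|lt [-> ->]]; rewrite efs ?orbT //=.
  by rewrite ltn_neqAle leqNgt lt andbT; apply/eqP => /(key_inj an bn).
- by exists (u, v); rewrite // /orient /= ltnNge (ltnW lt).
- by exists (v, u); rewrite // /orient /= lt.
Qed.

Lemma orient_lt u v : (u, v) \in os -> u < n /\ v < n.
Proof.
by rewrite orient_mem => /andP[/orP[] /(simple_mem fsP)[]].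
Qed.

Lemma unordered_orient e : unordered (orient e) = unordered e.
Proof. by rewrite /orient; case: ifP => _ //; rewrite /unordered /= minnC maxnC. Qed.

Lemma uniq_orient : uniq os.
Proof.
case/andP: fsP => _ u; apply: (@map_uniq _ _ unordered).
by rewrite -map_comp (eq_map unordered_orient).
Qed.

Lemma uniq_succs u : uniq (succs os u).
Proof.
rewrite map_inj_in_uniq ?filter_uniq ?uniq_orient // => -[a b] [c e].
by rewrite !mem_filter /= => /andP[/eqP-> _] /andP[/eqP-> _] ->.
Qed.

Lemma size_succs_le u : size (succs os u) <= deg fs u.
Proof.
rewrite size_map size_filter count_map /deg; apply: sub_count => e.
rewrite /preim /= /touch /orient; case: ifP => _ /= /eqP->; by rewrite eqxx ?orbT.
Qed.

(** The nesting of these lists follows the loops of the program, so its output is their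
    concatenation in the same order. *)
Definition triangles_at os u v :=
  [seq [:: u; v; w] | w <- succs os u & w \in succs os v].

Definition triangles_from os u :=
  flatten [seq triangles_at os u v | v <- succs os u].

Definition all_triangles n os := flatten [seq triangles_from os u | u <- iota 0 n].

Lemma all_trianglesP (s : seq nat) : reflect
  (exists u v w, [/\ s = [:: u; v; w], (u, v) \in os, (u, w) \in os & (v, w) \in os])
  (s \in all_triangles n os).
Proof.
apply: (iffP flatten_mapP) => [[u _ /flatten_mapP[v + /mapP[w + ->]]]|].
  by rewrite mem_filter !mem_succs => ? /andP[? ?]; exists u, v, w.
case=> u [v [w [-> uv uw vw]]]; have [un _] := orient_lt uv.
exists u; first by rewrite mem_iota.
apply/flatten_mapP; exists v; first by rewrite mem_succs.
by apply/mapP; exists w; rewrite // mem_filter !mem_succs uw vw.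
Qed.

(** The map [g] recovers the index of the block from any of its members, so distinct blocks are
    disjoint. *)
Lemma uniq_flatten_map (A B : eqType) (f : A -> seq B) (g : B -> A) (s : seq A) :
  uniq s -> (forall x, uniq (f x)) -> (forall x y, y \in f x -> g y = x) ->
  uniq (flatten [seq f x | x <- s]).
Proof.
move=> us uf fg; elim: s us => //= x s IH /andP[xs us].
rewrite cat_uniq uf IH // andbT; apply/hasPn => y /flatten_mapP[z zs yz].
by apply: contra xs => /fg <-; rewrite (fg _ _ yz).
Qed.

Lemma uniq_all_triangles : uniq (all_triangles n os).
Proof.
apply: (@uniq_flatten_map _ _ _ (fun s => nth 0 s 0)); first exact: iota_uniq.
  move=> u; apply: (@uniq_flatten_map _ _ _ (fun s => nth 0 s 1)).
  - exact: uniq_succs.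
  - by move=> v; rewrite map_inj_uniq ?filter_uniq ?uniq_succs // => a b [].
  - by move=> v y /mapP[w _ ->].
by move=> u y /flatten_mapP[v _ /mapP[w _ ->]].
Qed.

End Orientation.

(** With [r] the integer square root, [k < r.+1 ^ 2], and 6 is at most [3 ^ 2]. *)
Lemma sqrt_bound x k : x * x <= 6 * k -> x <= 3 * (PeanoNat.Nat.sqrt k).+1.
Proof.
have := PeanoNat.Nat.sqrt_specif k; move: (PeanoNat.Nat.sqrt k) => r [_ lt].
by move: lt; rewrite -!multE => /ltP; nia.
Qed.

Lemma sum_succs_sqr n fs k : simple n fs ->
  let d := deg fs in let os := map (orient n d) fs in
  (forall v, v < n -> d v != 1) ->
  size fs <= \sum_(0 <= v < n) (0 < d v) + k ->
  \sum_(0 <= u < n) size (succs os u) ^ 2 <=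
    36 * (k * PeanoNat.Nat.sqrt k) + 4 * n.
Proof.
move=> fsP d os d1 sz; set r := PeanoNat.Nat.sqrt k.
have excess : \sum_(0 <= v < n) (d v - 2) <= 2 * k.
  (* Termwise this reads [(d v - 2) + 2 * (0 < d v) = d v], true with truncated subtraction because
     no degree is 1. *)
  have: \sum_(0 <= v < n) (d v - 2) + 2 * \sum_(0 <= v < n) (0 < d v) = 2 * size fs.
    rewrite -(sum_deg fsP) big_distrr -big_split /= !big_nat.
    by apply: eq_bigr => v /d1; rewrite -/d; case: (d v) => [|[|x]] //; lia.
  lia.
pose big v := if 3 <= d v then d v else 0.
have sumbig : \sum_(0 <= v < n) big v <= 6 * k.
  (* A degree [x] of at least 3 satisfies [x <= 3 * (x - 2)]. *)
  apply: (@leq_trans (\sum_(0 <= v < n) 3 * (d v - 2))).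
    by apply: leq_sum => v _; rewrite /big; case: ifP; lia.
  by rewrite -big_distrr /=; lia.
(* The out-neighbours of [u] are distinct vertices of degree at least [d u], so the left side is at
   most their share of the sum of [big]. *)
have sq u : u < n -> 3 <= d u -> size (succs os u) * d u <= 6 * k.
  move=> un du; apply: leq_trans sumbig.
  apply: (@leq_trans (\sum_(v <- succs os u) big v)).
    rewrite -sum1_size big_distrl /= !big_seq; apply: leq_sum => v.
    rewrite mem_succs mul1n => uv; have [_ vn] := orient_lt fsP uv.
    have := uv; rewrite (orient_mem d fsP) => /andP[_ /(key_deg un vn) le].
    by rewrite /big (leq_trans du le).
  apply: (@sub_le_big_seq _ _ leq) => // [x y|].
    exact: leq_addr.
  move=> v; rewrite !count_uniq_mem ?(uniq_succs d fsP) ?iota_uniq //.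
  case: (boolP (v \in succs os u)) => //; rewrite mem_succs => /(orient_lt fsP)[_ vn].
  by rewrite mem_index_iota vn.
(* For [d u >= 3], one factor of the squared outdegree is at most [3 * r.+1] and the other at most
   [d u]. Otherwise the outdegree is at most 2, and 4 covers its square. *)
apply: (@leq_trans (\sum_(0 <= u < n) (3 * r.+1 * big u + 4))).
  rewrite !big_nat; apply: leq_sum => u /= un.
  have od : size (succs os u) <= d u := size_succs_le n d fs u; rewrite /big; case: ifP => du; last by nia.
  have := sq _ un du; set o := size _ in od *; move=> odk.
  have : o <= 3 * r.+1 by apply: sqrt_bound; nia.
  by nia.
rewrite big_split /= -big_distrr /= sum_nat_const_nat subn0.
(* The root [r] vanishes only for [k = 0]. Hence [18 * k * r.+1 <= 36 * (k * r)]. *)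
have : k <= k * r.
  by have := @PeanoNat.Nat.sqrt_specif k; rewrite -/r; case: (r) => [|r']; nia.
by nia.
Qed.

End EdgeLists.

(** * Edge lists over ordinals *)

Section Bridge.

Variables (n : nat) (es : seq ('I_n * 'I_n)).
Hypothesis esP : valid_edges es.

Definition nat_edge (e : 'I_n * 'I_n) : nat * nat := (val e.1, val e.2).
Let les := map nat_edge es.

Lemma set2_inj (T : finType) (a b x y : T) : [set a; b] = [set x; y] ->
  (a = x /\ b = y) \/ (a = y /\ b = x).
Proof.
move=> /setP E; have := (E a, E b, E x, E y); rewrite !inE !eqxx /= !orbT.
case=> [[[/esym/orP[]/eqP-> /esym/orP[]/eqP->]]]; rewrite ?eqxx ?orbb; auto.
  by move=> _ /eqP->; auto.
by move=> /eqP-> _; auto.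
Qed.

Lemma adj_linked (x y : 'I_n) : adj (edge_set es) x y = linked les x y.
Proof.
apply/imsetP/orP => [[e ees /set2_inj[[-> ->]|[-> ->]]]|].
- by left; apply/mapP; exists e.
- by right; apply/mapP; exists e.
case=> /mapP[e ees [/val_inj-> /val_inj->]]; exists e => //.
by rewrite setUC.
Qed.

Lemma simple_edges : simple n les.
Proof.
case/andP: esP => ne us; apply/andP; split.
  by apply/allP => _ /mapP[e /(allP ne) h ->] /=; rewrite !ltn_ord.
rewrite -map_comp map_inj_in_uniq; first exact: map_uniq us.
have inj : {in es &, injective (fun e : 'I_n * 'I_n => [set e.1; e.2])}.
  elim: (es) us => // e s IH /= /andP[es' us] x y.
  rewrite !in_cons => /predU1P[->|xs] /predU1P[->|ys] // E.
  - by case/negP: es'; rewrite E; apply: (map_f (fun e => [set e.1; e.2])).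
  - by case/negP: es'; rewrite -E; apply: (map_f (fun e => [set e.1; e.2])).
  - exact: IH us _ _ xs ys E.
move=> [a b] [x y] ein fin [/= E1 E2]; apply: inj => //=.
have mm (i j k l : nat) : minn i j = minn k l -> maxn i j = maxn k l ->
  (i = k /\ j = l) \/ (i = l /\ j = k) by lia.
case: (mm _ _ _ _ E1 E2) => -[/val_inj-> /val_inj->] //.
by rewrite setUC.
Qed.

Variable a : pred nat.
Let fs := induced a les.
Let d := deg fs.
Let os := map (orient n d) fs.

Lemma simple_fs : simple n fs.
Proof. exact: simple_induced simple_edges. Qed.

(** Apply [card_edges_le] with [W] the set of vertices of positive degree, which contains both ends
    of every remaining edge. *)
Lemma size_induced :
  size fs <= \sum_(0 <= v < n) (0 < d v) + feedback_edge_number (edge_set es).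
Proof.
pose fes := [seq e <- es | a (val e.1) && a (val e.2)].
have fsE : fs = map nat_edge fes by rewrite /fs /induced filter_map.
have -> : size fs = #|edge_set fes|.
  have -> : #|edge_set fes| = size [seq [set e.1; e.2] | e <- fes].
    rewrite -(card_uniqP _).
      by apply: eq_card => x; apply/imsetP/mapP => -[e ? ->]; exists e.
    case/andP: esP => _; apply: subseq_uniq.
    exact/map_subseq/filter_subseq.
  by rewrite fsE !size_map.
have -> : \sum_(0 <= v < n) (0 < d v) = #|[set v : 'I_n | 0 < d v]|.
  rewrite big_mkord -sum1dep_card [RHS]big_mkcond /=.
  by apply: eq_bigr => v _; case: (0 < d v).
apply: card_edges_le.
  by apply/subsetP => _ /imsetP[e + ->]; rewrite mem_filter => /andP[_ ein];
     apply/imsetP; exists e.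
move=> _ /imsetP[e ein ->]; split.
  case/andP: esP => /allP/(_ e) + _; rewrite cards2.
  by move: ein; rewrite mem_filter => /andP[_ ein] -> //.
have efs : nat_edge e \in fs by rewrite fsE; apply: map_f.
apply/subsetP => v; rewrite !inE => /orP[]/eqP->; rewrite -has_count;
  by apply/hasP; exists (nat_edge e); rewrite // /touch eqxx ?orbT.
Qed.

Hypothesis aP : triangle_alive les a.

Lemma linked_triangle x y z :
  linked les x y -> linked les y z -> linked les x z -> linked fs x y.
Proof.
move=> xy yz xz; have ax := aP xy yz xz.
have ay : a y by apply: (aP _ xz yz); rewrite linkedC.
by move: xy; rewrite /linked !mem_filter /= ax ay.
Qed.

Lemma linked_induced x y : linked fs x y -> linked les x y.
Proof.
by rewrite /linked !mem_filter => /orP[]/andP[_ ->]; rewrite ?orbT.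
Qed.

Lemma chunk_set3 (x y z : 'I_n) :
  chunk_set n [:: val x; val y; val z] = [set x; y; z].
Proof. by apply/setP => v; rewrite !inE -!val_eqE orbA. Qed.

Definition key_lt := relpre (key n d) ltn.

Lemma all_triangles_elem s : s \in all_triangles n os ->
  exists x y z : 'I_n, [/\ s = [:: val x; val y; val z], sorted key_lt s,
    linked fs x y, linked fs x z & linked fs y z].
Proof.
case/(all_trianglesP d simple_fs) => u [v [w [-> uv uw vw]]].
have [[un vn] [_ wn]] := (orient_lt simple_fs uv, orient_lt simple_fs uw).
exists (Ordinal un), (Ordinal vn), (Ordinal wn); split=> //=;
  move: uv uw vw; rewrite !(orient_mem d simple_fs) /key_lt /=;
  by do 3!case/andP=> ? ?; rewrite ?andbT //; apply/andP.
Qed.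

Lemma key_lt_irr : irreflexive key_lt.
Proof. by move=> x; rewrite /key_lt /= ltnn. Qed.

Lemma key_lt_trans : transitive key_lt.
Proof. by move=> y x z; apply: ltn_trans. Qed.

(** Each listed triple increases strictly in [key], so a triangle determines its triple. Conversely,
    sorting the corners of a triangle by [key] yields a listed triple, because its edges survive the
    peeling. *)
Lemma all_triangles_enumerates :
  enumerates (edge_set es) (flatten (all_triangles n os)).
Proof.
exists (all_triangles n os); split=> //; split; [|split].
- apply/allP => s /all_triangles_elem[x [y [z [-> so _ _ _]]]].
  apply/and3P; split=> //; last by rewrite /= !ltn_ord.
  exact: sorted_uniq key_lt_trans key_lt_irr _ so.
- rewrite map_inj_in_uniq ?(uniq_all_triangles d simple_fs) //.
  move=> s t /all_triangles_elem[x [y [z [-> so _ _ _]]]].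
  move=> /all_triangles_elem[x' [y' [z' [-> so' _ _ _]]]] E.
  (* Strictly sorted lists with the same members are equal; as all entries are below [n], membership
     can be read off the sets. *)
  apply: (irr_sorted_eq key_lt_trans key_lt_irr) => // v.
  have h (r : seq nat) : all (fun x => x < n) r ->
      (v \in r) = if insub v is Some v' then v' \in chunk_set n r else false.
    move=> rn; case: insubP => [v' _ <-|]; first by rewrite inE.
    by move=> vn; apply/negbTE; apply: contra vn => /(allP rn).
  by rewrite !h ?E //= !ltn_ord.
move=> T; split.
  case/mapP=> _ /all_triangles_elem[x [y [z [-> so xy xz yz]]]] ->.
  have := sorted_uniq key_lt_trans key_lt_irr so.
  rewrite /= !inE !val_eqE negb_or andbT => /andP[/andP[nxy nxz] nyz].
  rewrite chunk_set3; split.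
    rewrite -setUA !cardsU1 cards1 !inE; rewrite (negPf nxy) (negPf nxz) (negPf nyz).
    by [].
  have L u v : linked fs u v -> linked les u v by exact: linked_induced.
  move=> u v; rewrite !inE => /orP[/orP[]|]/eqP-> /orP[/orP[]|]/eqP->;
    by rewrite ?eqxx // => _; rewrite adj_linked ?(L _ _ xy) ?(L _ _ xz) ?(L _ _ yz) //
      linkedC ?(L _ _ xy) ?(L _ _ xz) ?(L _ _ yz).
case=> T3 adjT.
pose s := sort (relpre (key n d) leq) (map val (enum T)).
have su : uniq s by rewrite sort_uniq map_inj_uniq ?enum_uniq //; apply: val_inj.
have sz : size s = 3 by rewrite size_sort size_map -cardE.
have sT v : v \in s -> exists2 v' : 'I_n, v = val v' & v' \in T.
  by rewrite mem_sort => /mapP[v' + ->]; rewrite mem_enum; exists v'.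
have so : sorted (relpre (key n d) leq) s.
  by apply: sort_sorted => x y; apply: leq_total.
have TE : T = chunk_set n s.
  apply/setP => v; rewrite inE mem_sort mem_map ?mem_enum //; exact: val_inj.
rewrite TE; apply: map_f; move: sz su sT so {TE}.
case: s => [|x [|y [|z [|]]]] //= _ /and3P[].
rewrite !inE negb_or => /andP[nxy nxz] nyz _ sT /and3P[lxy lyz _].
have link u v : u \in [:: x; y; z] -> v \in [:: x; y; z] -> u != v -> linked les u v.
  by move=> /sT[u' -> uT] /sT[v' -> vT] uv; rewrite -adj_linked adjT.
have [xi yi zi] : [/\ x \in [:: x; y; z], y \in [:: x; y; z] & z \in [:: x; y; z]].
  by rewrite !inE !eqxx ?orbT.
have xy := link _ _ xi yi nxy; have xz := link _ _ xi zi nxz.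
have yz := link _ _ yi zi nyz.
(* Distinct vertices have distinct keys, so the weak order given by sorting is strict. *)
have lt u v : u \in [:: x; y; z] -> v \in [:: x; y; z] -> u != v ->
    key n d u <= key n d v -> key n d u < key n d v.
  move=> /sT[u' uE _] /sT[v' vE _] uv le; rewrite ltn_neqAle le andbT.
  by apply: contraNneq uv; rewrite uE vE => /key_inj ->.
apply/(all_trianglesP d simple_fs); exists x, y, z; split=> //; rewrite (orient_mem d simple_fs).
- by rewrite (linked_triangle xy yz xz) lt.
- have zy : linked les z y by rewrite linkedC.
  by rewrite (linked_triangle xz zy xy) lt //; exact: leq_trans lxy lyz.
- have zx : linked les z x by rewrite linkedC.
  have yx : linked les y x by rewrite linkedC.
  by rewrite (linked_triangle yz zx yx) lt.
Qed.

End Bridge.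

(** * The program *)

Declare Scope cmd_scope.
Delimit Scope cmd_scope with C.
Definition var (x : nat) := Cell 0 (Const x).
Notation "a .[ e ]" := (Cell a e) : cmd_scope.
Notation "e1 +' e2" := (Bin OAdd e1 e2) (at level 50, left associativity) : cmd_scope.
Notation "e1 -' e2" := (Bin OSub e1 e2) (at level 50, left associativity) : cmd_scope.
Notation "e1 *' e2" := (Bin OMul e1 e2) (at level 40, left associativity) : cmd_scope.
Notation "e1 <' e2" := (Bin OLt e1 e2) (at level 70, no associativity) : cmd_scope.
Notation "e1 =' e2" := (Bin OEq e1 e2) (at level 70, no associativity) : cmd_scope.
Notation "x ::= e" := (Store 0 (Const x) e) (at level 75) : cmd_scope.
Notation "c1 ;; c2" := (Seq c1 c2) (at level 80, right associativity) : cmd_scope.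
Local Open Scope cmd_scope.

(* [Out] lists the out-neighbours of each vertex and [Mat] is the oriented
   adjacency matrix, both stored by rows of length [n]; [Cnt] is the outdegree. *)
Notation vn := 0 (only parsing). Notation vm := 1 (only parsing). Notation vi := 2 (only parsing). Notation vu := 3 (only parsing).
Notation vv := 4 (only parsing). Notation vw := 5 (only parsing). Notation vj := 6 (only parsing). Notation vl := 7 (only parsing).
Notation Deg := 1 (only parsing). Notation Sum := 2 (only parsing). Notation Cnt := 3 (only parsing).
Notation Out := 4 (only parsing). Notation Mat := 5 (only parsing).

Definition read_edge :=
  vu ::= Input (Const 2 +' Const 2 *' var vi) ;;
  vv ::= Input (Const 3 +' Const 2 *' var vi).

Definition incr x := x ::= var x +' Const 1.

Definition read_body :=
  read_edge ;;
  Store Deg (var vu) (Deg.[var vu] +' Const 1) ;;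
  Store Deg (var vv) (Deg.[var vv] +' Const 1) ;;
  Store Sum (var vu) (Sum.[var vu] +' var vv) ;;
  Store Sum (var vv) (Sum.[var vv] +' var vu) ;;
  incr vi.

Definition read_graph :=
  vn ::= Input (Const 0) ;; vm ::= Input (Const 1) ;; vi ::= Const 0 ;;
  While (var vi <' var vm) read_body.

Definition peel_body :=
  vu ::= Sum.[var vw] ;;
  Store Deg (var vw) (Const 0) ;;
  Store Sum (var vw) (Const 0) ;;
  Store Deg (var vu) (Deg.[var vu] -' Const 1) ;;
  Store Sum (var vu) (Sum.[var vu] -' var vw) ;;
  vw ::= var vu.

(** Deleting a leaf can create a new leaf only at its neighbour, so following neighbours until the
    degree differs from 1 leaves no leaf behind among the vertices already scanned. *)
Definition peel_chain :=
  vw ::= var vi ;;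
  While (Deg.[var vw] =' Const 1) peel_body ;;
  incr vi.

Definition peel_graph :=
  vi ::= Const 0 ;; While (var vi <' var vn) peel_chain.

Definition key_code x := Deg.[var x] *' var vn +' var x.

Definition insert_edge :=
  If (key_code vv <' key_code vu) (vw ::= var vu ;; vu ::= var vv ;; vv ::= var vw) ;;
  Store Out (var vu *' var vn +' Cnt.[var vu]) (var vv) ;;
  Store Cnt (var vu) (Cnt.[var vu] +' Const 1) ;;
  Store Mat (var vu *' var vn +' var vv) (Const 1).

Definition orient_body :=
  read_edge ;; If (Deg.[var vu] *' Deg.[var vv]) insert_edge ;; incr vi.

Definition orient_graph :=
  vi ::= Const 0 ;; While (var vi <' var vm) orient_body.

Definition print_triangle := Print (var vu) ;; Print (var vv) ;; Print (var vw).

Definition list_at :=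
  vw ::= Out.[var vu *' var vn +' var vl] ;;
  If (Mat.[var vv *' var vn +' var vw]) print_triangle ;;
  incr vl.

Definition list_from :=
  vv ::= Out.[var vu *' var vn +' var vj] ;;
  vl ::= Const 0 ;; While (var vl <' Cnt.[var vu]) list_at ;;
  incr vj.

Definition list_body :=
  vj ::= Const 0 ;; While (var vj <' Cnt.[var vu]) list_from ;; incr vu.

Definition list_triangles :=
  vu ::= Const 0 ;; While (var vu <' var vn) list_body.

Definition triangle_cmd :=
  read_graph ;; peel_graph ;; orient_graph ;; list_triangles.

Arguments wp : simpl never.

Section Program.

Variables (n : nat) (es : seq (nat * nat)).
Hypothesis esP : simple n es.
Let m := size es.

Variables (inp : seq nat) (V : nat).
Hypotheses (inp0 : nth 0 inp 0 = n) (inp1 : nth 0 inp 1 = m).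
Hypothesis edge_input : forall i, i < m ->
  nth 0 inp (2 + 2 * i) = (nth (0, 0) es i).1 /\
  nth 0 inp (3 + 2 * i) = (nth (0, 0) es i).2.
Hypothesis inp_le : forall i, nth 0 inp i <= V.
Hypotheses (V_n : n <= V) (V_m : m <= V) (V_nm : n * m <= V) (V_32 : 32 <= V).

Lemma wp_store a e1 e2 (Q : state -> Prop) s i v :
  eval inp (cell s) e1 = i -> eval inp (cell s) e2 = v -> v <= V ->
  Q (write s a i v) -> wp inp V (Store a e1 e2) Q s.
Proof. by move=> <- <- vV HQ; split. Qed.

Ltac focus := lazymatch goal with
  |- wp ?i ?V ?c ?Q ?s => let c' := eval hnf in c in
    lazymatch c' with
    | Seq ?c1 ?c2 => change (wp i V c1 (wp i V c2 Q) s); focus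
    | _ => change (wp i V c' Q s)
    end
  end.
Tactic Notation "store" constr(i) constr(v) := focus; apply: (@wp_store _ _ _ _ _ i v).

Lemma edge_lt i : i < m -> let e := nth (0, 0) es i in
  [/\ e.1 < n, e.2 < n & e.1 <> e.2].
Proof. by move=> im; apply: simple_mem esP _; apply: mem_nth. Qed.

(** Three initial stores, then one test and seven stores per edge. The cells that remain zero will
    serve as empty rows and as the zero matrix. *)
Definition read_inv i s :=
  [/\ [/\ cell s 0 vn = n, cell s 0 vm = m & cell s 0 vi = i],
      forall v, cell s Deg v = deg (take i es) v,
      forall v, cell s Sum v = nsum (take i es) v,
      forall a v, 2 < a -> cell s a v = 0 &
      outp s = [::] /\ clock s <= 3 + 8 * i].

Lemma take_deg_le i v : deg (take i es) v <= m.
Proof. by apply: leq_trans (deg_le _ _) _; rewrite size_take_min; lia. Qed.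

Lemma take_nsum_le i v : nsum (take i es) v <= V.
Proof.
apply: leq_trans V_nm; apply: leq_trans (nsum_le _ _) _.
  exact: simple_subseq (take_subseq _ _) esP.
by rewrite leq_mul2l size_take_min geq_minr orbT.
Qed.

Lemma read_step i s : read_inv i s -> i < m ->
  wp inp V read_body (read_inv i.+1) (tick s).
Proof.
move=> [[hn hm hi] hD hS hZ [ho hc]] im.
have [i1 i2] := edge_input im; have [e1 e2 ne] := edge_lt im.
have ts : take i.+1 es = rcons (take i es) (nth (0, 0) es i) by exact: take_nth.
move: (nth (0, 0) es i) i1 i2 e1 e2 ne ts => [u v] /= i1 i2 e1 e2 ne ts.
have uv : (u == v) = false by apply/eqP.
have d1 := take_deg_le i.+1 u; have d2 := take_deg_le i.+1 v.
have s1 := take_nsum_le i.+1 u; have s2 := take_nsum_le i.+1 v.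
have q1 : deg (take i.+1 es) u = deg (take i es) u + 1.
  by rewrite ts deg_rcons /touch /= eqxx.
have q2 : deg (take i.+1 es) v = deg (take i es) v + 1.
  by rewrite ts deg_rcons /touch /= eqxx orbT.
have q3 : nsum (take i.+1 es) u = nsum (take i es) u + v.
  by rewrite ts nsum_rcons /opposite /= eqxx eq_sym uv mul1n addn0.
have q4 : nsum (take i.+1 es) v = nsum (take i es) v + u.
  by rewrite ts nsum_rcons /opposite /= eqxx uv mul1n.
store vu u => //; first by rewrite /= hi.
  lia.
store vv v => //; first by rewrite /= /setc /= hi.
  lia.
store u (deg (take i.+1 es) u) => //.
  by rewrite /= /setc /= hD q1.
  lia.
store v (deg (take i.+1 es) v) => //.
  by rewrite /= /setc /= hD q2 (eq_sym v) uv.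
  lia.
store u (nsum (take i.+1 es) u) => //.
  by rewrite /= /setc /= hS q3.
store v (nsum (take i.+1 es) v) => //.
  by rewrite /= /setc /= hS q4 (eq_sym v) uv.
store vi i.+1 => //; first by rewrite /= /setc /= hi addn1.
  lia.
split; rewrite /= /setc /=; try by split=> //; lia.
- move=> x; case: eqP => [->//|/eqP xv]; case: eqP => [->//|/eqP xu].
  by rewrite hD ts deg_rcons /touch /= !(eq_sym _ x) (negPf xu) (negPf xv) addn0.
- move=> x; case: eqP => [->//|/eqP xv]; case: eqP => [->//|/eqP xu].
  by rewrite hS ts nsum_rcons /opposite /= !(eq_sym _ x) (negPf xu) (negPf xv) addn0.
- by move=> a x; case: a => [|[|[|a]]] //= _; rewrite hZ.
Qed.

Lemma wp_for N (I : nat -> state -> Prop) e c s (Q : state -> Prop) :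
  I 0 s ->
  (forall i s, I i s -> i <= N -> eval inp (cell s) e = (i < N)) ->
  (forall i s, I i s -> i < N -> wp inp V c (I i.+1) (tick s)) ->
  (forall s, I N s -> Q (tick s)) ->
  wp inp V (While e c) Q s.
Proof.
move=> I0 test body post; apply: (triple_for V_32 inp_le I0 _ body post) => i s' Ii iN.
by rewrite (test i) // eqb0 -leqNgt eqn_leq iN.
Qed.

Lemma wp_if e c s (Q : state -> Prop) :
  (if eval inp (cell s) e == 0 then Q (tick s) else wp inp V c Q (tick s)) ->
  wp inp V (If e c) Q s.
Proof. by []. Qed.

Lemma wp_print e s v (Q : state -> Prop) :
  eval inp (cell s) e = v -> Q (print s v) -> wp inp V (Print e) Q s.
Proof. by move=> <-. Qed.

Lemma read_graph_wp (Q : state -> Prop) :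
  (forall s, read_inv m s -> Q (tick s)) ->
  wp inp V read_graph Q (State (fun _ _ => 0) [::] 0).
Proof.
move=> HQ.
store vn n => //.
store vm m => //.
store vi 0 => //; focus; apply: (wp_for (N := m) (I := read_inv)) => //.
- rewrite /read_inv take0; split=> //=.
    by move=> v; rewrite /nsum big_nil.
  by case=> [|[|[|a]]].
- by move=> i s [[_ hm hi] _ _ _ _] _; rewrite /= hi hm.
- exact: read_step.
Qed.

(** * Verification of the peeling phase *)

Definition peel_state (a : pred nat) s :=
  [/\ triangle_alive es a, cell s 0 vn = n /\ cell s 0 vm = m,
      (forall v, cell s Deg v = deg (induced a es) v) /\
      (forall v, cell s Sum v = nsum (induced a es) v),
      forall b v, 2 < b -> cell s b v = 0 & outp s = [::]].

Lemma peel_state_var a s x v : 1 < x -> peel_state a s ->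
  peel_state a (write s 0 x v).
Proof.
case: x => [|[|x]] // _ [ta hnm hDS hZ ho]; split=> //.
by move=> b y; rewrite /= /setc /=; case: b => //= b; apply: hZ.
Qed.

Definition alive s := \sum_(0 <= v < n) (0 < cell s Deg v).

Lemma alive_decr s s' w : w < n -> 0 < cell s Deg w -> cell s' Deg w = 0 ->
  (forall v, cell s' Deg v <= cell s Deg v) -> alive s' < alive s.
Proof.
move=> wn sw s'w le; rewrite /alive !big_mkord.
rewrite (bigD1 (Ordinal wn)) //= [X in _ < X](bigD1 (Ordinal wn)) //= sw s'w.
rewrite add0n add1n ltnS; apply: leq_sum => v _; have := le v.
by case: (cell s' Deg v) => // x; case: (cell s Deg v).
Qed.

Lemma alive_le s : alive s <= n.
Proof.
apply: (@leq_trans (\sum_(0 <= v < n) 1)); last by rewrite sum_nat_const_nat subn0 muln1.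
by apply: leq_sum => v _; case: (0 < _).
Qed.

(* The clock plus seven times the number of vertices still to be removed grows
   only by a constant per vertex of the outer loop. *)
Definition peel_inv i s := exists a,
  [/\ peel_state a s, cell s 0 vi = i,
      forall v, v < i -> deg (induced a es) v != 1 &
      clock s + 7 * alive s <= 8 * m + 7 * n + 4 * i + 5].

(** Only the current vertex [w] may be a leaf among those scanned. Compared with [peel_inv], the
    clock allows two more units, for the outer test and the store to [vw]. *)
Definition chain_inv i s := exists a w,
  [/\ peel_state a s, cell s 0 vi = i /\ (cell s 0 vw = w /\ w < n),
      forall v, v < i.+1 -> v != w -> deg (induced a es) v != 1 &
      clock s + 7 * alive s <= 8 * m + 7 * n + 4 * i + 7].

Lemma chain_step i s : chain_inv i s -> cell s Deg (cell s 0 vw) = 1 ->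
  wp inp V peel_body (fun s' => chain_inv i s' /\ alive s' < alive s) (tick s).
Proof.
move=> [a [w [[ta [hn hm] [hD hS] hZ ho] [hi [hw wn]] low ck]]].
rewrite hw hD => dw.
have gP : simple n (induced a es) by exact: simple_induced.
have [un uw dE sE] := leaf_peel gP dw.
set u := nsum _ w in un uw dE sE; rewrite -induced_remove in dE sE.
have sV v : nsum (induced a es) v <= V.
  apply: leq_trans (nsum_le v gP) _; apply: leq_trans V_nm.
  by rewrite leq_mul2l size_subseq ?filter_subseq ?orbT.
have du : deg (induced (remove a w) es) u = deg (induced a es) u - 1.
  by rewrite dE (negPf uw) eqxx.
have su : nsum (induced (remove a w) es) u = nsum (induced a es) u - w.
  by rewrite sE (negPf uw) eqxx mul1n.
store vu u => //; first by rewrite /= hw hS.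
  exact: sV.
store w 0 => //.
store w 0 => //.
store u (deg (induced (remove a w) es) u) => //.
    by rewrite /= /setc /= (negPf uw) hD du.
  apply: leq_trans V_m; apply: leq_trans (deg_le _ _) _.
  exact/size_subseq/filter_subseq.
store u (nsum (induced (remove a w) es) u) => //.
    by rewrite /= /setc /= (negPf uw) hS hw su.
  by rewrite su; apply: leq_trans (leq_subr _ _) (sV u).
store vw u => //; first by lia.
set s' := write _ _ _ _.
have hD' v : cell s' Deg v = deg (induced (remove a w) es) v.
  rewrite /s' /= /setc /=; case: eqP => [->//|/eqP vu]; rewrite dE.
  by case: eqP => // _; rewrite hD (negPf vu) subn0.
have al : alive s' < alive s.
  apply: (alive_decr wn); first by rewrite hD dw.
    by rewrite hD' dE eqxx.
  by move=> v; rewrite hD' hD dE; case: eqP => // _; apply: leq_subr.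
split=> //; exists (remove a w), u; split.
- split=> //.
  + exact: (triangle_alive_remove esP ta dw).
  + split=> // v; rewrite /s' /= /setc /=; case: eqP => [->//|/eqP vu]; rewrite sE.
    by case: eqP => // _; rewrite hS (negPf vu) mul0n subn0.
  + by move=> b v; rewrite /s' /= /setc /=; case: b => [|[|[|b]]] //= _; rewrite hZ.
- by rewrite /s' /= /setc /=.
- move=> v vi1 vu; rewrite dE (negPf vu) subn0.
  by case: (eqVneq v w) => // vw1; apply: low.
- by move: ck al; rewrite /s' /=; lia.
Qed.

Lemma peel_step i s : peel_inv i s -> i < n ->
  wp inp V peel_chain (peel_inv i.+1) (tick s).
Proof.
move=> [a [ps hi low ck]] lt.
store vw i => //; first by lia.
focus; apply: (triple_while V_32 inp_le (I := chain_inv i) (mu := alive)).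
  exists a, i; split=> //=.
  - exact: (@peel_state_var a (tick s)).
  - move=> v; rewrite ltnS leq_eqVlt => /orP[/eqP->|/low //]; by rewrite eqxx.
  - by move: ck; rewrite /alive /= /setc /=; lia.
move=> s1 I1; case: ifP => [|/negbT] /=; last first.
  rewrite eqb0 negbK => /eqP; exact: chain_step.
rewrite eqb0; case: I1 => [a1 [w [ps1 [hi1 [hw1 wn1]] low1 ck1]]].
rewrite hw1; have [_ _ [-> _] _ _] := ps1 => dw1.
store vi i.+1 => //; first by rewrite /= hi1 addn1.
  lia.
exists a1; split=> //=.
- exact: (@peel_state_var a1 (tick s1)).
(* The loop has ended because [w], the one possible exception, is not a leaf. *)
- by move=> v vi1; case: (eqVneq v w) => [->//|]; apply: low1.
- by move: ck1; rewrite /alive /= /setc /=; lia.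
Qed.

Lemma peel_graph_wp s (Q : state -> Prop) :
  read_inv m s ->
  (forall s, peel_inv n s -> Q (tick s)) ->
  wp inp V peel_graph Q (tick s).
Proof.
move=> [[hn hm hi] hD hS hZ [ho hc]] HQ.
store vi 0 => //; focus; apply: (wp_for (N := n) (I := peel_inv)) => //.
- exists predT.
  have iT : induced predT es = es by apply: filter_predT.
  rewrite /peel_state iT; split=> //=.
  + split=> //; first by split=> v; rewrite /setc /= ?hD ?hS take_size.
    by move=> b v; rewrite /setc /=; case: b => //= b; apply: hZ.
  + by have := alive_le (write (tick s) 0 vi 0); lia.
- by move=> i s' [a [[_ [hn' _] _ _ _] hi' _ _]] _; rewrite /= hi' hn'.
- exact: peel_step.
Qed.

(** * Verification of the orientation phase *)

Lemma index_eq u v j l : j < n -> l < n ->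
  (u * n + j == v * n + l) = (u == v) && (j == l).
Proof.
move=> jn ln; apply/eqP/andP => [E|[/eqP-> /eqP->] //].
have n0 : 0 < n by lia.
have := congr1 (divn^~ n) E; rewrite !divnMDl // !divn_small // !addn0 => uv.
by split; apply/eqP => //; move: E; rewrite uv; lia.
Qed.

Definition arrays (os : seq (nat * nat)) s :=
  [/\ forall u, cell s Cnt u = size (succs os u),
      forall u j, u < n -> j < size (succs os u) ->
        cell s Out (u * n + j) = nth 0 (succs os u) j &
      forall u v, u < n -> v < n -> cell s Mat (u * n + v) = (v \in succs os u)].

Lemma arrays_cell os s s' : (forall b v, 2 < b -> cell s' b v = cell s b v) ->
  arrays os s -> arrays os s'.
Proof.
by move=> ss [h1 h2 h3]; split=> *; rewrite ss // ?h1 ?h2 ?h3.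
Qed.

Lemma arrays_var os s x v : arrays os s -> arrays os (write s 0 x v).
Proof. by apply: arrays_cell => -[|b]. Qed.

Lemma arrays_insert os s u v :
  (forall x, size (succs os x) <= n) -> size (succs os u) < n -> u < n -> v < n ->
  arrays os s ->
  arrays (rcons os (u, v))
    (write (write (write s Out (u * n + size (succs os u)) v)
       Cnt u (size (succs os u)).+1) Mat (u * n + v) 1).
Proof.
move=> sn sun un vn1 [h1 h2 h3]; split=> [x|x j xn|x y xn yn];
  rewrite /= /setc /= !succs_rcons /=.
- rewrite eq_sym; case: (eqVneq u x) => [->|//]; first by rewrite size_rcons.
- case: (eqVneq u x) => [<-{x xn}|ux].
    rewrite size_rcons ltnS => js; have jn : j < n by lia.
    rewrite index_eq // eqxx /= nth_rcons; case: (ltngtP j (size _)) js => // js _.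
    exact: h2.
  move=> js; have jn : j < n by apply: leq_trans js (sn x).
  by rewrite index_eq // (eq_sym x) (negPf ux) /= h2.
- rewrite index_eq // (eq_sym x); case: (eqVneq u x) => [<-|ux] /=; last exact: h3.
  by rewrite mem_rcons in_cons; case: eqP => //= _; rewrite h3.
Qed.

Section Oriented.

Variable a : pred nat.
Let d := deg (induced a es).

(** Only the edge list is cut off at [i]; edges are directed by the degrees [d] in the whole peeled
    graph. *)
Definition oriented i := map (orient n d) (induced a (take i es)).

Lemma simple_take i : simple n (induced a (take i es)).
Proof. exact/simple_induced/(simple_subseq (take_subseq _ _) esP). Qed.

Lemma size_succs_oriented i u : size (succs (oriented i) u) <= n.
Proof.
rewrite -[X in _ <= X](size_iota 0); apply: uniq_leq_size.
  exact/uniq_succs/simple_take.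
by move=> v; rewrite mem_succs mem_iota => /(orient_lt (simple_take i))[].
Qed.

(** The product of degrees tests survival: a deleted vertex has degree 0, while both ends of a
    surviving edge have positive degree. *)
Lemma oriented_step i : i < m -> let e := nth (0, 0) es i in
  oriented i.+1 = if d e.1 * d e.2 == 0 then oriented i
    else rcons (oriented i) (orient n d e).
Proof.
move=> im e; rewrite /oriented (take_nth (0, 0)) // /induced filter_rcons -/e.
have ein : e \in es by apply: mem_nth.
case: ifP => [/andP[a1 a2]|/negbT]; last first.
  by rewrite negb_and => /orP[] /deg_dead h; rewrite /d h ?muln0.
have efs : e \in induced a es by rewrite mem_filter a1 a2.
rewrite map_rcons muln_eq0 !eqn0Ngt !(deg_gt0 efs) //; by rewrite /touch eqxx ?orbT.
Qed.

(** Twelve units per edge: loop test, two reads, degree test, key test, three moves, three stores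
    and the increment. *)
Definition orient_inv i s :=
  [/\ [/\ cell s 0 vn = n, cell s 0 vm = m & cell s 0 vi = i],
      forall v, cell s Deg v = d v, arrays (oriented i) s, outp s = [::] &
      clock s <= 8 * m + 11 * n + 9 + 12 * i].

Lemma insert_step i s : orient_inv i s -> i < m ->
  let e := nth (0, 0) es i in d e.1 * d e.2 != 0 ->
  wp inp V insert_edge (wp inp V (incr vi) (orient_inv i.+1))
    (tick (write (write (tick s) 0 vu e.1) 0 vv e.2)).
Proof.
move=> [[hn hm hi] hD har ho hc] im e en0.
have [e1 e2 ne] := edge_lt im; rewrite -/e in e1 e2 ne.
have := oriented_step im; rewrite /= -/e (negPf en0) => os'.
(* The bound [n] on the row after the insertion shows that the row had a free slot before it. *)
have := size_succs_oriented i.+1 (orient n d e).1.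
rewrite os'; move E: (orient n d e) os' => [u v] os'.
rewrite succs_rcons /= eqxx size_rcons => sz.
have [un vn1] : u < n /\ v < n.
  have : (orient n d e).1 < n /\ (orient n d e).2 < n by rewrite /orient; case: ifP.
  by rewrite E.
(* [R] covers both outcomes of the swap, so the stores that follow are verified once. *)
pose R s' := [/\ [/\ cell s' 0 vn = n, cell s' 0 vm = m & cell s' 0 vi = i],
  cell s' 0 vu = u /\ cell s' 0 vv = v,
  forall b x, 0 < b -> cell s' b x = cell s b x, outp s' = [::] &
  clock s' <= clock s + 8].
have rest s' : R s' -> wp inp V
  (Store Out (var vu *' var vn +' Cnt.[var vu]) (var vv) ;;
   Store Cnt (var vu) (Cnt.[var vu] +' Const 1) ;;
   Store Mat (var vu *' var vn +' var vv) (Const 1))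
   (wp inp V (incr vi) (orient_inv i.+1)) s'.
  move=> [[rn rm ri] [ru rv] rc ro rk]; have [h1 h2 h3] := har.
  store (u * n + size (succs (oriented i) u)) v => //.
  - by rewrite /= ru rn rc // h1.
  - lia.
  store u (size (succs (oriented i) u)).+1 => //.
  - by rewrite /= /setc /= ru rc // h1 addn1.
  - lia.
  store (u * n + v) 1 => //.
  - by rewrite /= /setc /= ru rv rn.
  - lia.
  store vi i.+1 => //; last 1 first.
  - split=> //=; last by rewrite /=; lia.
    + by move=> x; rewrite /setc /= rc.
    + rewrite os'; apply: arrays_var; apply: arrays_insert => //.
        by move=> x; apply: size_succs_oriented.
      by apply: arrays_cell har => b x b2; rewrite rc //; lia.
  - by rewrite /= /setc /= ri addn1.
  - lia.
focus; apply: wp_if.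
have -> : (eval inp (cell (tick (write (write (tick s) 0 vu e.1) 0 vv e.2)))
    (key_code vv <' key_code vu) == 0) = ~~ (key n d e.2 < key n d e.1).
  by rewrite /= /setc /= eqb0 !hD hn.
move: E; rewrite /orient; case: ifP => _ /= E; last first.
  apply: rest; split=> //=; last by lia.
    by rewrite /setc /= E.
  by move=> b x; case: b.
case: E => uE vE; store vw e.1 => //; first by lia.
store vu e.2 => //; first by lia.
store vv e.1 => //; first by lia.
apply: rest; split=> //=; last by lia.
by move=> b x; case: b.
Qed.

Lemma orient_step i s : orient_inv i s -> i < m ->
  wp inp V orient_body (orient_inv i.+1) (tick s).
Proof.
move=> I im; have [[hn hm hi] hD har ho hc] := I.
have [i1 i2] := edge_input im; have [e1 e2 ne] := edge_lt im.
have h := insert_step I im; have os' := oriented_step im.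
set e := nth (0, 0) es i in i1 i2 e1 e2 ne h os'.
store vu e.1 => //; first by rewrite /= hi.
  lia.
store vv e.2 => //; first by rewrite /= /setc /= hi.
  lia.
focus; apply: wp_if.
have -> : eval inp (cell (write (write (tick s) 0 vu e.1) 0 vv e.2))
  (Deg.[var vu] *' Deg.[var vv]) = d e.1 * d e.2 by rewrite /= /setc /= !hD.
case: ifP => [e0|/negbT]; last exact: h.
rewrite /= e0 in os'.
store vi i.+1 => //; first by rewrite /= /setc /= hi addn1.
  lia.
split=> //=; last by lia.
by rewrite os'; do 3!apply: arrays_var.
Qed.

Lemma orient_graph_wp s (Q : state -> Prop) :
  peel_state a s -> clock s <= 8 * m + 11 * n + 6 ->
  (forall s, orient_inv m s -> Q (tick s)) ->
  wp inp V orient_graph Q (tick s).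
Proof.
move=> [_ [hn hm] [hD _] hZ ho] hc HQ.
store vi 0 => //; focus; apply: (wp_for (N := m) (I := orient_inv)) => //.
- split=> //=; last by lia.
  apply: arrays_var; rewrite /oriented take0.
  by split=> *; rewrite /= hZ.
- by move=> i s' [[_ hm' hi'] _ _ _ _] _; rewrite /= hi' hm'.
- exact: orient_step.
Qed.

End Oriented.

(** * Verification of the listing phase *)

Section List.

Variables (a : pred nat) (T : nat).
Let os := map (orient n (deg (induced a es))) (induced a es).

Lemma os_oriented : oriented a m = os.
Proof. by rewrite /oriented take_size. Qed.

Lemma size_succs_os u : size (succs os u) <= n.
Proof. by rewrite -os_oriented size_succs_oriented. Qed.

Lemma nth_succs_lt u j : j < size (succs os u) -> nth 0 (succs os u) j < n.
Proof.
move=> js; have := mem_nth 0 js; rewrite mem_succs => uv.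
by have [] := orient_lt (simple_induced a esP) uv.
Qed.

Definition at_inv u v j o c l s :=
  [/\ [/\ cell s 0 vn = n, cell s 0 vu = u, cell s 0 vv = v, cell s 0 vj = j &
        cell s 0 vl = l], arrays os s,
      outp s = o ++ flatten
        [seq [:: u; v; w] | w <- take l (succs os u) & w \in succs os v] &
      clock s <= c + 7 * l].

Lemma at_step u v j o c l s : u < n -> v < n -> at_inv u v j o c l s ->
  l < size (succs os u) -> wp inp V list_at (at_inv u v j o c l.+1) (tick s).
Proof.
move=> un vn1 [[hn hu hv hj hl] har ho hc] ls.
have [h1 h2 h3] := har; have sz := size_succs_os u; have wn := nth_succs_lt ls.
have tE : take l.+1 (succs os u) = rcons (take l (succs os u)) (nth 0 (succs os u) l).
  exact: take_nth.
set w := nth 0 _ _ in wn tE.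
store vw w => //; first by rewrite /= hu hn hl h2.
  lia.
focus; apply: wp_if.
have -> : eval inp (cell (write (tick s) 0 vw w)) (Mat.[var vv *' var vn +' var vw])
  = (w \in succs os v) by rewrite /= /setc /= hv hn h3.
rewrite eqb0; case: ifP => win.
  store vl l.+1 => //; first by rewrite /= /setc /= hl addn1.
    lia.
  split=> //=; last by lia.
  by rewrite ho tE filter_rcons (negPf win).
focus; apply: (@wp_print _ _ u) => //.
focus; apply: (@wp_print _ _ v) => //.
focus; apply: (@wp_print _ _ w) => //.
store vl l.+1 => //; first by rewrite /= /setc /= hl addn1.
  lia.
split=> //=; last by lia.
move/negbFE: win => win.
by rewrite ho tE filter_rcons win map_rcons flatten_rcons catA -!cats1 -!catA.
Qed.

Definition from_inv u o c j s :=
  [/\ [/\ cell s 0 vn = n, cell s 0 vu = u & cell s 0 vj = j], arrays os s,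
      outp s = o ++ flatten (flatten
        [seq triangles_at os u v | v <- take j (succs os u)]) &
      clock s <= c + j * (7 * size (succs os u) + 5)].

Lemma from_step u o c j s : u < n -> from_inv u o c j s ->
  j < size (succs os u) -> wp inp V list_from (from_inv u o c j.+1) (tick s).
Proof.
move=> un [[hn hu hj] har ho hc] js.
have [h1 h2 h3] := har; have sz := size_succs_os u; have vn1 := nth_succs_lt js.
have tE : take j.+1 (succs os u) = rcons (take j (succs os u)) (nth 0 (succs os u) j).
  exact: take_nth.
set v := nth 0 _ _ in vn1 tE.
store vv v => //; first by rewrite /= hu hn hj h2.
  lia.
store vl 0 => //; focus.
apply: (wp_for (N := size (succs os u)) (I := at_inv u v j (outp s) (clock s + 3))).
- split=> //=; last by lia.
  by rewrite take0 cats0.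
- by move=> l s' [[hn' hu' hv' hj' hl'] [h1' _ _] _ _] _; rewrite /= hu' hl' h1'.
- by move=> l s' I ls; apply: at_step.
move=> s' [[hn' hu' hv' hj' hl'] har' ho' hc'].
store vj j.+1 => //; first by rewrite /= hj' addn1.
  lia.
split=> //=; last by lia.
by rewrite ho' ho take_size tE map_rcons flatten_rcons flatten_cat catA.
Qed.

(** With outdegree [x] the inner loops cost [x * (7 * x + 5)], at most [12 * x ^ 2]; the 4 pays for
    two tests, the reset of [vj] and the increment of [vu]. *)
Definition list_inv u s :=
  [/\ cell s 0 vn = n /\ cell s 0 vu = u, arrays os s,
      outp s = flatten (flatten [seq triangles_from os x | x <- iota 0 u]) &
      clock s <= T + \sum_(0 <= x < u) (12 * size (succs os x) ^ 2 + 4)].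

Lemma list_step u s : list_inv u s -> u < n ->
  wp inp V list_body (list_inv u.+1) (tick s).
Proof.
move=> [[hn hu] har ho hc] un.
store vj 0 => //; focus.
apply: (wp_for (N := size (succs os u)) (I := from_inv u (outp s) (clock s + 2))).
- split=> //=; last by lia.
  by rewrite take0 cats0.
- by move=> j s' [[hn' hu' hj'] [h1' _ _] _ _] _; rewrite /= hu' hj' h1'.
- by move=> j s' I js; apply: from_step.
move=> s' [[hn' hu' hj'] har' ho' hc'].
store vu u.+1 => //; first by rewrite /= hu' addn1.
  lia.
split=> //.
- rewrite [outp _]/= ho' ho take_size -addn1 iotaD map_cat flatten_cat /= cats0.
  by rewrite flatten_cat.
- rewrite big_nat_recr //=; move: hc hc'; set x := size _; set S := \sum_(_ <= _ < _) _.
  have : x <= x * x by case: (x) => [|y]; nia.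
  by rewrite expnS expn1; lia.
Qed.

Lemma list_triangles_wp s (Q : state -> Prop) :
  orient_inv a m s -> clock s + 2 <= T ->
  (forall s, list_inv n s -> Q (tick s)) ->
  wp inp V list_triangles Q (tick s).
Proof.
move=> [[hn hm hi] hD har ho hc] sT HQ.
store vu 0 => //; focus; apply: (wp_for (N := n) (I := list_inv)) => //.
- rewrite os_oriented in har; split=> //=; last by lia.
- by move=> u s' [[hn' hu'] _ _ _] _; rewrite /= hu' hn'.
- exact: list_step.
Qed.

End List.

Lemma triangle_cmd_wp : wp inp V triangle_cmd
  (fun s => exists a, [/\ triangle_alive es a,
     forall v, v < n -> deg (induced a es) v != 1 &
     let os := map (orient n (deg (induced a es))) (induced a es) in
     outp s = flatten (all_triangles n os) /\
     clock s <= 20 * m + 15 * n + 13 +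
       12 * \sum_(0 <= u < n) size (succs os u) ^ 2])
  (State (fun _ _ => 0) [::] 0).
Proof.
focus; apply: read_graph_wp => s1 I1.
focus; apply: peel_graph_wp I1 _ => s2 [a [ps2 hi2 low ck2]].
focus; apply: (orient_graph_wp ps2); first by lia.
move=> s3 I3.
(* The time [T] covers the first three phases and the start of the listing. *)
apply: (list_triangles_wp (T := 20 * m + 11 * n + 12) I3).
  by case: I3 => _ _ _ _; lia.
move=> s4 [_ _ out4 ck4]; exists a; have [ta _ _ _ _] := ps2; split=> //; split=> //.
apply: leq_ltn_trans ck4 _.
by rewrite big_split /= -big_distrr /= sum_nat_const_nat subn0; lia.
Qed.

End Program.

Local Close Scope cmd_scope.

(** * Running time and correctness *)

Lemma nth_flatten_pairs (es : seq (nat * nat)) i : i < size es ->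
  let s := flatten [seq [:: e.1; e.2] | e <- es] in
  nth 0 s (2 * i) = (nth (0, 0) es i).1 /\ nth 0 s (2 * i).+1 = (nth (0, 0) es i).2.
Proof.
elim: es i => // e es IH [|i] lt; first by rewrite muln0.
by rewrite mulnS -[2 + 2 * i]/((2 * i).+2); apply: IH.
Qed.

Lemma nth_flatten_le n (es : seq (nat * nat)) i : simple n es ->
  nth 0 (flatten [seq [:: e.1; e.2] | e <- es]) i <= n.
Proof.
elim: es i => [|e es IH] i /andP[/= al u]; first by rewrite nth_nil.
case/andP: al => /and3P[e1 e2 _] al.
case: i => [|[|i]] /=; [exact: ltnW|exact: ltnW|].
by apply: IH; rewrite /simple al; case/andP: u.
Qed.

Lemma runs_le P inp t o B B' : B <= B' -> runs P inp t o B -> runs P inp t o B'.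
Proof. by move=> le [h1 h2]; split=> // i c it ec a; apply: leq_trans (h1 i c it ec a) le. Qed.

Lemma triangle_cmd_correct n (es : seq ('I_n * 'I_n)) : valid_edges es ->
  let k := feedback_edge_number (edge_set es) in
  exists t o,
    [/\ runs (cmd_code 0 triangle_cmd) (encode es) t o ((n + size es + 2) ^ 105),
      enumerates (edge_set es) o &
      t <= unit_cost * (500 * (k * PeanoNat.Nat.sqrt k + n + size es + 1))].
Proof.
move=> esP k; pose les := map (@nat_edge n) es.
have lesP : simple n les := simple_edges esP.
have sE : size les = size es by rewrite size_map.
(* The exponent 5 gives [V >= 2 ^ 5 = 32]; then [bound] is [V ^ 21 = x ^ 105]. *)
pose x := n + size es + 2; pose V := x ^ 5.
have x2 : 2 <= x by rewrite /x; lia.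
have V32 : 32 <= V by rewrite -[32]/(2 ^ 5) leq_exp2r.
have VX : x * x <= V by rewrite mulnn leq_exp2l.
have inpE : encode es =
    [:: n, size les & flatten [seq [:: e.1; e.2] | e <- les]].
  by rewrite /encode sE -map_comp.
have nV : n <= V by rewrite /x in VX; nia.
have mV : size les <= V by rewrite sE; rewrite /x in VX; nia.
have nmV : n * size les <= V by rewrite sE; rewrite /x in VX; nia.
have inp_le i : nth 0 (encode es) i <= V.
  rewrite inpE; case: i => [|[|i]] //=.
  exact: leq_trans (nth_flatten_le _ lesP) nV.
have edge_input i : i < size les ->
    nth 0 (encode es) (2 + 2 * i) = (nth (0, 0) les i).1 /\
    nth 0 (encode es) (3 + 2 * i) = (nth (0, 0) les i).2.
  by move=> /nth_flatten_pairs; rewrite inpE.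
have h := triangle_cmd_wp lesP _ _ edge_input inp_le nV mV nmV V32.
have wf : wf_cmd triangle_cmd by vm_compute.
have [t [s [r le [a [ta low [oE ck]]]]]] :=
  wp_runs V32 inp_le wf (h ltac:(by rewrite inpE) ltac:(by rewrite inpE)).
exists t, (outp s); split.
- by apply: runs_le r; rewrite /bound -expnM leq_exp2l.
- by rewrite oE; apply: all_triangles_enumerates.
apply: leq_trans le _; rewrite leq_mul2l; apply/orP; right; apply: leq_trans ck _.
(* The largest coefficient is [12 * 36 = 432], which 500 covers. *)
have := sum_succs_sqr (simple_induced a lesP) low (size_induced esP a).
by rewrite -/k sE; lia.
Qed.

Theorem theorem1 :
  exists (P : program) (c : nat),
    forall (n : nat) (es : seq ('I_n * 'I_n)),
      valid_edges es ->
      let E := edge_set es in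
      let k := feedback_edge_number E in
      exists (t : nat) (o : seq nat),
        runs P (encode es) t o ((n + size es + 2) ^ c) /\
        enumerates E o /\
        t <= c * (k * PeanoNat.Nat.sqrt k + n + size es + 1).
Proof.
(* One constant serves as time factor and as exponent of the word size, where 105 would do. *)
exists (cmd_code 0 triangle_cmd), (unit_cost * 500) => n es esP E k.
have [t [o [r e le]]] := triangle_cmd_correct esP.
exists t, o; split; last by split=> //; rewrite -mulnA.
apply: runs_le r; rewrite leq_exp2l; last by lia.
by rewrite /unit_cost; lia.
Qed.
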